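(* Let $d$ be a positive integer and let $A$ and $B$ be measurable sets of finite positive measure in $\mathbb{R}^d$. Then there is a constant $c$, depending only on the dimension $d$ and on the ratio of the volumes $|A|$ and $|B|$, such that the following holds: for each positive integer $n$, if $b_1,\dots,b_n$ are chosen independently and uniformly at random from $B$, then $$\mathbb{E}\Big(\Big|\bigcup_{i=1}^n(A+b_i)\Big|\Big)\ \ge\ \big(|A|^{1/d}+|B|^{1/d}\big)^d\cdot\Big(1-(c+o(1))\,n^{-2/(d+1)}\Big)\qquad\text{as } n\to\infty .$$
   Context: $|\cdot|$ denotes Lebesgue measure on $\mathbb{R}^d$, and $A+b=\{a+b: a\in A\}$. The term $o(1)$ denotes a quantity tending to $0$ as $n\to\infty$ with $d$, $A$, $B$ fixed. *)

(* Defs.v *)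
From HB Require Import structures.
From mathcomp Require Import all_boot all_order all_algebra.
From mathcomp Require Import all_classical all_reals all_analysis.

Set Implicit Arguments.
Unset Strict Implicit.
Unset Printing Implicit Defensive.

Import Order.TTheory GRing.Theory Num.Theory.
Import numFieldNormedType.Exports.

Local Open Scope classical_set_scope.
Local Open Scope ring_scope.

Section lebesgue_rV.
Context {R : realType} {d : nat}.
Local Notation rV := 'rV[R]_d.

(* [Some (a, b)] encodes the half-open box \prod_i ]a_i, b_i]. [None] encodes
   the empty set: since every box has volume 1 when d = 0, covers must be
   allowed to be finite for the outer measure of set0 to be 0 in all cases. *)
Definition box (I : option (rV * rV)) : set rV :=
  if I is Some (a, b) then [set x | forall i, a 0 i < x 0 i <= b 0 i]
  else set0.

Definition box_volume (I : option (rV * rV)) : \bar R :=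
  if I is Some (a, b) then (\prod_i Num.max 0 (b 0 i - a 0 i))%:E else 0%E.

Definition lebesgue_outer_rV (X : set rV) : \bar R :=
  ereal_inf [set (\sum_(k <oo) box_volume (F k))%E |
              F in [set F : nat -> _ | X `<=` \bigcup_k box (F k)]].

Local Open Scope ereal_scope.

Lemma box_volume_ge0 I : 0 <= box_volume I.
Proof.
case: I => [[a b]|] //=; rewrite lee_fin.
by apply: prodr_ge0 => i _; rewrite le_max lexx.
Qed.

Lemma lebesgue_outer_rV_ge0 X : 0 <= lebesgue_outer_rV X.
Proof.
apply: le_ereal_inf_tmp => _ [F _ <-].
by apply: nneseries_ge0 => k _ _; exact: box_volume_ge0.
Qed.

Lemma le_lebesgue_outer_rV :
  {homo lebesgue_outer_rV : X Y / X `<=` Y >-> X <= Y}.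
Proof.
move=> X Y XY; apply: ereal_inf_le_tmp => _ [F /= YF <-].
by exists F => //=; exact: subset_trans XY YF.
Qed.

Lemma lebesgue_outer_rV0 : lebesgue_outer_rV set0 = 0.
Proof.
apply/eqP; rewrite eq_le lebesgue_outer_rV_ge0 andbT.
apply: ereal_inf_lbound; exists (fun=> None) => /=; first exact: sub0set.
by rewrite eseries0.
Qed.

Lemma lebesgue_outer_rV_sigma_subadditive : sigma_subadditive lebesgue_outer_rV.
Proof.
move=> A; have [[i ioo]|] := pselect (exists i, lebesgue_outer_rV (A i) = +oo).
  rewrite (eseries_pinfty _ _ ioo) ?leey// => n _.
  by rewrite -ltNye (lt_le_trans _ (lebesgue_outer_rV_ge0 _)).
rewrite -forallNE => Aoo.
suff add2e (e : {posnum R}) : lebesgue_outer_rV (\bigcup_n A n) <=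
    \sum_(i <oo) lebesgue_outer_rV (A i) + e%:num%:E.
  by apply/lee_addgt0Pr => _/posnumP[].
rewrite (le_trans _ (epsilon_trick _ _ _))//; last first.
  by move=> n; exact: lebesgue_outer_rV_ge0.
pose P n (F : nat -> option (rV * rV)) := A n `<=` \bigcup_k box (F k) /\
  \sum_(k <oo) box_volume (F k) <=
    lebesgue_outer_rV (A n) + (e%:num / (2 ^ n.+1)%:R)%:E.
have [G PG] : {G : nat -> nat -> option (rV * rV) & forall n, P n (G n)}.
  apply: (@choice _ _ P) => n.
  have fA : lebesgue_outer_rV (A n) \is a fin_num.
    by rewrite ge0_fin_numE ?lebesgue_outer_rV_ge0// ltey; exact/eqP/Aoo.
  have en1 : (0 < e%:num / (2 ^ n.+1)%:R)%R by [].
  have [_ [F AF <-] /ltW ?] := lb_ereal_inf_adherent en1 fA.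
  by exists F.
pose v (nk : nat * nat) := box_volume (G nk.1 nk.2).
have v_ge0 nk : 0 <= v nk by exact: box_volume_ge0.
apply: (@le_trans _ _ (\esum_(i in setT) v i)).
  apply: ereal_inf_lbound => /=.
  have /card_esym/ppcard_eqP[f] := card_nat2.
  exists (fun k => G (f k).1 (f k).2).
    move=> t [n _] /(PG n).1[k _ Gt].
    by exists (f^-1%FUN (n, k)) => //=; rewrite invK ?inE.
  rewrite -(esum_pred_image v f xpredT) ?[fun=> _]set_true//.
  by rewrite image_eq.
rewrite (_ : esum _ _ = \sum_(i <oo) \sum_(j <oo) v (i, j)); last first.
  pose J : nat -> set (nat * nat) := fun i => [set (i, j) | j in setT].
  rewrite (_ : setT = \bigcup_k J k); last first.
    by rewrite predeqE => -[a b]; split => // _; exists a => //; exists b.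
  rewrite esum_bigcupT /=; last 2 first.
    - apply/trivIsetP => i j _ _ ij.
      rewrite predeqE => -[n m] /=; split => //= -[] [_] _ [<-{n} _].
      by move=> [m' _] [] /esym/eqP; rewrite (negbTE ij).
    - by [].
  rewrite -(image_id [set: nat]) -fun_true esum_pred_image//; last first.
    by move=> n _; exact: esum_ge0.
  apply: eq_eseriesr => /= j _.
  rewrite -(esum_pred_image v (pair j) predT)//=; last first.
    by move=> ? ? _ _; exact: (@can_inj _ _ _ snd).
  by congr esum; rewrite predeqE => -[a b]; split; move=> [i _ <-]; exists i.
by apply: lee_nneseries => [n _ _|n _]; [exact: nneseries_ge0|exact: (PG n).2].
Qed.

HB.instance Definition _ := isOuterMeasure.Build R rV lebesgue_outer_rV
  lebesgue_outer_rV0 lebesgue_outer_rV_ge0 le_lebesgue_outer_rV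
  lebesgue_outer_rV_sigma_subadditive.

Definition lebesgue_measure_rV :
  set (caratheodory_type lebesgue_outer_rV) -> \bar R := lebesgue_outer_rV.
HB.instance Definition _ := isMeasure.Build _ _ _ lebesgue_measure_rV
  (@caratheodory_measure0 R rV lebesgue_outer_rV)
  (@caratheodory_measure_ge0 R rV lebesgue_outer_rV)
  (@caratheodory_measure_sigma_additive R rV lebesgue_outer_rV).

Definition lebesgue_measurable_rV (A : set rV) : Prop :=
  lebesgue_outer_rV.-cara.-measurable A.

End lebesgue_rV.

(* Only meaningful for sets of finite measure, since [fine +oo = 0]. *)
Definition volume {R : realType} {d : nat} (A : set 'rV[R]_d) : R :=
  fine (lebesgue_measure_rV A).

Definition translate {R : realType} {d : nat} (A : set 'rV[R]_d)
    (b : 'rV[R]_d) : set 'rV[R]_d := [set a + b | a in A].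

Definition borel_rV (R : realType) (d : nat) :=
  g_sigma_algebraType (@open 'rV[R]_d).

Section random_variables.
Context {disp disp' : measure_display} {Omega : measurableType disp}
  {T : measurableType disp'} {R : realType} (P : probability Omega R).
Local Open Scope ereal_scope.

Definition mutually_independent {I : finType} (X : I -> {RV P >-> T}) : Prop :=
  forall (J : {set I}) (S : I -> set T), (forall i, measurable (S i)) ->
    P (\bigcap_(i in [set` J]) (X i @^-1` S i)) =
    \prod_(i in J) P (X i @^-1` S i).

End random_variables.

(* Random vectors are Borel measurable, whereas B may be any Lebesgue measurable
   set: the law of X is prescribed on Borel sets only. *)
Definition uniform_on {disp : measure_display} {Omega : measurableType disp}
    {R : realType} {d : nat} (P : probability Omega R) (B : set 'rV[R]_d)
    (X : {RV P >-> borel_rV R d}) : Prop :=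
  forall S : set (borel_rV R d), measurable S ->
    distribution P X S = (volume (S `&` B) / volume B)%:E.

(* Main.v *)
From HB Require Import structures.
Require Import Defs.
From mathcomp Require Import all_boot all_order all_algebra.
From mathcomp Require Import all_classical all_reals all_analysis.
From mathcomp Require Import measurable_realfun ring lra zify.

Set Implicit Arguments.
Unset Strict Implicit.
Unset Printing Implicit Defensive.

Import Order.TTheory GRing.Theory Num.Theory.
Import numFieldNormedType.Exports.

Local Open Scope classical_set_scope.
Local Open Scope ring_scope.

(* Fubini and independence give
     E|U (A + b_i)| = int 1 - (1 - f(z)/|B|)^n dz,  f(z) = |{y in B : z - y in A}|,
   and the concave integrand dominates a positive combination of truncations
   min(f, t). The Riesz-Sobolev inequality says that for every t the integral
   of min(f, t) is smallest when A and B are replaced by balls of the same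
   volumes; for those, f >= t on the ball of radius r(A) + r(B) - dl, where dl
   is of order t^(2/(d+1)) because a lens of thickness dl has volume of order
   dl^((d+1)/2).
   Riesz-Sobolev is proved by Steiner symmetrization. On the line it follows
   from Pollard's argument (corr1_le). In R^d, if A differs from its ball then
   some translation by v moves a definite proportion of A \ ball into
   ball \ A, and symmetrizing along v brings that mass into the ball; hence the
   infimum of the defects over all sequences of symmetrizations is 0. *)

(** * Lebesgue measure on the Borel sets of R^d *)

(** With [S = {f > t}], the integral of [min(f, t)] is [|A||B| + t|S|] minus the integral of [f]
    over [S]. So Riesz-Sobolev is wanted only as an upper bound for [f] integrated over [S], and for
    balls that bound uses nothing about [S] except its volume. Hence [S] is merely dragged along
    through the symmetrizations, its shape is forgotten, and no limit of sets is ever taken: it is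
    enough to bring [A] and [B] within small measure of balls, with an error that can be made
    arbitrarily small. Euclidean geometry enters through measure alone: uniqueness of
    translation-invariant measures shows that reflections preserve volume and dilations scale it, so
    determinants never appear. The truncation levels are [t = (j+1)|B|/n] for [j < n], with weights
    that halve at each step. Weighted by [j+1] they sum to 1 up to [2/n], and level [j] loses a
    relative amount of order [((j+1)/n)^(2/(d+1))]. The moments of the weights stay bounded, so the
    constant is the explicit [2 + 3 * lens_const] and the inequality holds for every [n], with
    [o(1) = 0]. *)

Section borel.
Context {R : realType}.
Implicit Types d : nat.

Definition qcube d (q : 'rV[rat]_d) (k : nat) : set 'rV[R]_d :=
  [set x | forall i, `|ratr (q 0 i) - x 0 i| < k.+1%:R^-1].

(** Rational cubes are a countable base of the sup-norm topology. This is what lets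
    [measurable_fun_rV] deduce Borel measurability from that of the coordinates. *)
Lemma open_bigcup_qcube d (U : set 'rV[R]_d) : open U ->
  U = \bigcup_(p in [set p : 'rV[rat]_d * nat | qcube p.1 p.2 `<=` U])
        qcube p.1 p.2.
Proof.
move=> oU; apply/seteqP; split; last by move=> x [p pU /pU].
move=> x Ux; have := open_nbhs_nbhs (conj oU Ux).
rewrite -nbhs_ballE => -[e /= e0 eU].
have [k ke] : exists k : nat, (k.+1%:R^-1 : R) < e / 2.
  have := @cvg_harmonic R => /cvgrPdist_lt /(_ (e / 2)).
  rewrite divr_gt0// => /(_ isT) [k _ /(_ k) /=].
  by rewrite leqnn sub0r normrN ger0_norm// => /(_ isT) ke; exists k.
pose dl := (k.+1%:R^-1 : R).
have d0 : 0 < dl by rewrite invr_gt0.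
have qP i : exists q : rat, `|ratr q - x 0 i| < dl.
  have [|q] := @rat_in_itvoo R (x 0 i) (x 0 i + dl); first by rewrite ltrDl.
  rewrite in_itv/= => /andP[q1 q2]; exists q; rewrite ger0_norm ?subr_ge0 ?ltW//.
  by rewrite ltrBlDl.
pose q : 'rV[rat]_d := \row_i sval (cid (qP i)).
have xq : qcube q k x by move=> i; rewrite mxE; case: cid.
exists (q, k) => //= y yq; apply: eU; split => // i j; rewrite ord1.
rewrite /ball/=.
have := ltrD (xq j) (yq j) => /= h.
rewrite (le_lt_trans (ler_distD (ratr (q 0 j)) _ _))// distrC.
by rewrite (lt_trans h)// -/dl; rewrite -/dl in ke; lra.
Qed.

Lemma measurable_coord d (i : 'I_d) :
  measurable_fun setT (fun x : borel_rV R d => (x : 'rV[R]_d) 0 i).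
Proof.
apply: (measurability _ (measurable_realfun.RGenOInfty.measurableE R)).
move=> _ [_ [a ->] <-]; rewrite setTI; apply: sub_sigma_algebra.
apply: (@open_comp _ _ (fun x : 'rV[R]_d => x 0 i)); last exact: interval_open.
by move=> x _; exact: coord_continuous.
Qed.

Lemma measurable_fun_rV d disp (T : measurableType disp) (f : T -> borel_rV R d) :
  (forall i, measurable_fun setT (fun t => (f t : 'rV[R]_d) 0 i)) ->
  measurable_fun setT f.
Proof.
move=> mf; apply: (@measurability _ _ _ _ setT f open) => //.
move=> _ [U oU <-]; rewrite setTI (open_bigcup_qcube oU) preimage_bigcup.
rewrite bigcup_mkcond; apply: countable_bigcupT_measurable.
  exact: countableP.
move=> p; case: ifP => // _; rewrite [X in measurable X](_ : _ =
    \bigcap_(i in [set: 'I_d]) (fun t => (f t : 'rV[R]_d) 0 i) @^-1`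
      ball (ratr (p.1 0 i) : R) (p.2.+1%:R^-1)).
  apply: fin_bigcap_measurable => // i _; rewrite -[X in measurable X]setTI.
  by apply: mf => //; exact: measurable_ball.
by apply/seteqP; split=> t /= h i; [move=> _; exact: h|exact: h].
Qed.

(** The coordinate split off is [ord0]; it is also the axis along which [steiner] symmetrizes. *)
Definition vcons d (p : borel_rV R d * measurableTypeR R) : borel_rV R d.+1 :=
  \row_i (if unlift ord0 i is Some j then (p.1 : 'rV_d) 0 j else p.2).

Definition vtail d (x : borel_rV R d.+1) : borel_rV R d :=
  \row_j (x : 'rV_d.+1) 0 (lift ord0 j).

Definition vhead d (x : borel_rV R d.+1) : measurableTypeR R :=
  (x : 'rV_d.+1) 0 ord0.

Lemma vcons0 d (p : borel_rV R d * measurableTypeR R) :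
  (vcons p : 'rV_d.+1) 0 ord0 = p.2.
Proof. by rewrite mxE unlift_none. Qed.

Lemma vconsS d (p : borel_rV R d * measurableTypeR R) j :
  (vcons p : 'rV_d.+1) 0 (lift ord0 j) = (p.1 : 'rV_d) 0 j.
Proof. by rewrite mxE liftK. Qed.

Lemma vconsK d : cancel (@vcons d) (fun x => (vtail x, vhead x)).
Proof.
move=> [y r]; congr pair; last by rewrite /vhead vcons0.
by apply/rowP => j; rewrite mxE vconsS.
Qed.

Lemma vheadtailK d : cancel (fun x => (vtail x, vhead x)) (@vcons d).
Proof.
move=> x; apply/rowP => i; rewrite mxE/=.
by case: unliftP => [j|] ->//; rewrite mxE.
Qed.

Lemma measurable_vcons d : measurable_fun setT (@vcons d).
Proof.
apply: measurable_fun_rV => i; case: (unliftP ord0 i) => [j|] ->.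
  rewrite (_ : (fun t => _) =
      (fun x : borel_rV R d => (x : 'rV_d) 0 j) \o fst); last first.
    by apply/funext => p; rewrite vconsS.
  by apply: measurableT_comp => //; exact: measurable_coord.
by rewrite (_ : (fun t => _) = snd)//; apply/funext => p; rewrite vcons0.
Qed.

Lemma measurable_vhead d : measurable_fun setT (@vhead d).
Proof. exact: measurable_coord. Qed.

Lemma measurable_vtail d : measurable_fun setT (@vtail d).
Proof.
apply: measurable_fun_rV => i; under eq_fun do rewrite mxE.
exact: measurable_coord.
Qed.

End borel.

(** * Lebesgue measure on R^d as an iterated product *)

Definition leb (R : realType) :
  {sigma_finite_measure set (measurableTypeR R) -> \bar R} := lebesgue_measure.

Section mu_step.
Context {R : realType} (d : nat).
Variable m : {sigma_finite_measure set (borel_rV R d) -> \bar R}.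

Definition mu_step : set (borel_rV R d.+1) -> \bar R :=
  pushforward (m \x leb R)%E (@vcons R d).

HB.instance Definition _ := Measure.copy mu_step
  (measure_function_pushforward__canonical__measure_function_Measure
    (m \x leb R)%E (@measurable_vcons R d)).

Let mu_step_sigma_finite : sigma_finite setT mu_step.
Proof.
have /sigma_finiteP[F [TF ndF Foo]] := sigma_finiteT m.
have /sigma_finiteP[G [TG ndG Goo]] := sigma_finiteT (leb R).
exists (fun n => (@vtail R d) @^-1` F n `&` (@vhead R d) @^-1` G n).
  apply/seteqP; split => // x _.
  have : setT (vtail x) by []. 
  have : setT (vhead x) by [].
  rewrite TG TF => -[i _ Gi] [j _ Fj].
  exists (maxn i j) => //; split => /=.
    by move: Fj; exact/subsetPset/ndF/leq_maxr.
  by move: Gi; exact/subsetPset/ndG/leq_maxl.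
move=> k; have [mF Fk] := Foo k; have [mG Gk] := Goo k; split.
  apply: measurableI; rewrite -[X in measurable X]setTI.
    exact: measurable_vtail.
  exact: measurable_vhead.
rewrite /mu_step /pushforward (_ : _ @^-1` _ = F k `*` G k).
  by rewrite product_measure1E// lte_mul_pinfty// ge0_fin_numE.
by apply/seteqP; split=> -[y r] /=; have := vconsK (y, r) => -[-> ->].
Qed.

HB.instance Definition _ :=
  Measure_isSigmaFinite.Build _ _ _ mu_step mu_step_sigma_finite.

Definition mu_step_sf : {sigma_finite_measure set (borel_rV R d.+1) -> \bar R} :=
  mu_step.
End mu_step.

Section mu0.
Context {R : realType}.
Definition mu0 : set (borel_rV R 0) -> \bar R := @dirac _ (borel_rV R 0) (0 : 'rV[R]_0) R.
HB.instance Definition _ := Measure.on mu0.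
Let mu0_sigma_finite : sigma_finite setT mu0.
Proof.
apply: fin_num_fun_sigma_finite; first by rewrite measure0.
by move=> U mU; rewrite /mu0 diracE.
Qed.
HB.instance Definition _ :=
  Measure_isSigmaFinite.Build _ _ _ mu0 mu0_sigma_finite.
Definition mu0_sf : {sigma_finite_measure set (borel_rV R 0) -> \bar R} := mu0.
End mu0.

(** Iterating products puts Fubini along coordinate [ord0] into the definition. That this is the
    measure of the theorem is shown in [mu_outer]. *)
Fixpoint mu_rec (R : realType) (d : nat) :
    {sigma_finite_measure set (borel_rV R d) -> \bar R} :=
  if d is d'.+1 then mu_step_sf (mu_rec R d') else mu0_sf.

(* Locked: unification otherwise unfolds the recursion. *)
Fact mu_key : unit. Proof. exact: tt. Qed.
Definition mu_rV (R : realType) (d : nat) :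
    {sigma_finite_measure set (borel_rV R d) -> \bar R} :=
  locked_with mu_key (mu_rec R d).

Section mu_theory.
Context {R : realType}.
Local Notation leb := (leb R).

Lemma muS d (X : set (borel_rV R d.+1)) :
  mu_rV R d.+1 X = (mu_rV R d \x leb)%E (@vcons R d @^-1` X).
Proof. by rewrite /mu_rV !unlock. Qed.

Lemma measurable_box d (I : option ('rV[R]_d * 'rV[R]_d)) :
  measurable (box I : set (borel_rV R d)).
Proof.
case: I => [[a b]|]; last exact: measurable0.
rewrite [X in measurable X](_ : _ = \bigcap_(i in [set: 'I_d])
    (fun t => (t : 'rV[R]_d) 0 i) @^-1` `]a 0 i, b 0 i]).
  apply: fin_bigcap_measurable => // i _; rewrite -[X in measurable X]setTI.
  by apply: measurable_coord.
apply/seteqP; split=> t /= h i.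
  by move=> _; rewrite /= in_itv/=; exact: h.
by have /= := h i I; rewrite in_itv.
Qed.

Lemma mu_box d (I : option ('rV[R]_d * 'rV[R]_d)) :
  mu_rV R d (box I) = box_volume I.
Proof.
case: I => [[a b]|]; last exact: measure0.
elim: d => [|d IH] in a b *.
  by rewrite /box_volume big_ord0 /mu_rV unlock /= /mu0 diracE mem_set// => -[].
rewrite muS [X in (_ \x _)%E X](_ : _ =
    (box (Some (vtail a, vtail b)) : set (borel_rV R d)) `*`
       (`]a 0 ord0, b 0 ord0]%classic : set (measurableTypeR R))).
  rewrite product_measure1E//; last exact: (measurable_box (Some _)).
  transitivity (box_volume (Some (vtail a : 'rV[R]_d, vtail b : 'rV[R]_d)) *
      (Num.max 0 (b 0 ord0 - a 0 ord0))%:E)%E.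
    congr (_ * _)%E; first exact: IH.
    rewrite [LHS]lebesgue_measure_itv /= lte_fin.
    case: ltP => ab; last by rewrite (elimT max_idPl)// subr_le0.
    by rewrite (elimT max_idPr) ?EFinB// subr_ge0 ltW.
  rewrite /box_volume -EFinM big_ord_recl mulrC; congr (_ * _)%:E.
  by apply: eq_bigr => i _; rewrite !mxE.
apply/seteqP; split => -[y r] /=.
  move=> h; split; last by have := h ord0; rewrite vcons0 in_itv.
  by move=> i; have := h (lift ord0 i); rewrite vconsS !mxE.
rewrite in_itv/= => -[h h0] i; case: (unliftP ord0 i) => [j|] ->.
  by rewrite vconsS; have := h j; rewrite !mxE.
by rewrite vcons0.
Qed.

End mu_theory.

(** * Comparison with the outer measure; Borel approximation *)

Section outer.
Context {R : realType} {d : nat}.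
Local Notation outer := (@lebesgue_outer_rV R d).
Local Notation borel := (borel_rV R d).

Let cut_lo (i : 'I_d) (c : R) (I : option ('rV[R]_d * 'rV[R]_d)) :=
  if I is Some (a, b) then
    Some (a, \row_j if j == i then Num.min (b 0 j) c else b 0 j) else None.
Let cut_hi (i : 'I_d) (c : R) (I : option ('rV[R]_d * 'rV[R]_d)) :=
  if I is Some (a, b) then
    Some (\row_j (if j == i then Num.max (a 0 j) c else a 0 j), b) else None.

(** If the hyperplane misses the box, one part gets a side of nonpositive length, which [Num.max 0]
    in [box_volume] counts as 0. *)
Let cut_volume i c I :
  box_volume (cut_lo i c I) + box_volume (cut_hi i c I) = box_volume I :> \bar R.
Proof.
case: I => [[a b]|] /=; last by rewrite adde0.
rewrite -EFinD; congr EFin.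
rewrite (bigD1 i)//= (bigD1 i (F := fun j => Num.max 0 (b 0 j - _)))//=.
rewrite (bigD1 i (F := fun j => Num.max 0 (b 0 j - a 0 j)))//=.
rewrite !mxE eqxx.
set p := \prod_(_ | _) _; set q := \prod_(_ | _) _; set r := \prod_(_ | _) _.
have -> : p = r by apply: eq_bigr => j ji; rewrite mxE (negbTE ji).
have -> : q = r by apply: eq_bigr => j ji; rewrite mxE (negbTE ji).
rewrite -mulrDl; congr (_ * _).
move: (a 0 i) (b 0 i) => u v.
by case: (ltP v c) => h1; case: (ltP u c) => h2;
  do 3?[case: (ltP 0 (_ - _)) => ?]; lra.
Qed.

(** Cutting every box of a cover along the hyperplane gives covers of the two parts of [X] with the
    same total volume. *)
Lemma caratheodory_halfspace (i : 'I_d) (c : R) :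
  outer.-caratheodory [set x : 'rV[R]_d | x 0 i <= c].
Proof.
apply: le_caratheodory_measurable => X.
apply: le_ereal_inf_tmp => _ [F XF <-].
under eq_eseriesr do rewrite -(cut_volume i c).
rewrite nneseriesD; [|by move=> k _ _; exact: box_volume_ge0..].
apply: leeD; apply: ereal_inf_lbound.
  exists (fun k => cut_lo i c (F k)) => // x [/XF[k _ Fkx] xc]; exists k => //.
  move: Fkx; case: (F k) => [[a b]|]//= h j; rewrite mxE.
  by have [->|] := eqVneq j i; rewrite ?h// le_min xc andbT h.
exists (fun k => cut_hi i c (F k)) => // x [/XF[k _ Fkx] /negP].
rewrite -ltNge => xc; exists k => //.
move: Fkx; case: (F k) => [[a b]|]//= h j; rewrite mxE.
by have [->|] := eqVneq j i; rewrite ?h// gt_max xc andbT h.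
Qed.

Lemma caratheodory_borel (X : set borel) : measurable X ->
  outer.-caratheodory X.
Proof.
move=> mX.
have : measurable_fun setT (fun x : caratheodory_type outer => x : borel).
  apply: measurable_fun_rV => i.
  apply: (measurability _ (RGenOInfty.measurableE R)).
  move=> _ [_ [a ->] <-]; rewrite setTI -[X in measurable X]setCK.
  apply: measurableC; rewrite [X in measurable X](_ : _ =
    [set x : 'rV[R]_d | x 0 i <= a]); first exact: caratheodory_halfspace.
  by apply/seteqP; split=> x /=; rewrite in_itv/= andbT leNgt => /negP.
by move=> /(_ measurableT X mX); rewrite setTI.
Qed.

(** The lower bound, classically a compactness argument, comes from countable subadditivity of
    [mu_rV], whose value on boxes is already known. *)
Lemma outer_box (I : option ('rV[R]_d * 'rV[R]_d)) : outer (box I) = box_volume I.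
Proof.
apply/eqP; rewrite eq_le; apply/andP; split.
  apply: ereal_inf_lbound; exists (fun k : nat => if k == 0%N then I else None).
    by move=> x Ix; exists 0%N.
  rewrite nneseries_recl//; last by move=> k _; exact: box_volume_ge0.
  by rewrite eseries0 ?adde0// => -[].
apply: le_ereal_inf_tmp => _ [F IF <-].
under eq_eseriesr do rewrite -mu_box.
rewrite -mu_box; apply: measure_sigma_subadditive => //.
- by move=> k; exact: measurable_box.
- exact: measurable_box.
Qed.

Lemma coord_bounded (x : 'rV[R]_d) : exists n : nat, forall j, `|x 0 j| < n%:R.
Proof.
exists (Num.bound (\sum_j `|x 0 j|)) => j.
rewrite (@le_lt_trans _ _ (\sum_j `|x 0 j|))// ?archi_boundP ?sumr_ge0//.
by rewrite (bigD1 j)//= lerDl sumr_ge0.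
Qed.

(** On Borel sets the outer measure is the pushforward of the Caratheodory measure along the
    identity; this gives it the measure structure that [measure_unique] compares. *)
Definition outer_borel (X : set borel) : \bar R := outer X.

Let id_meas : measurable_fun setT (fun x : caratheodory_type outer => x : borel).
Proof. by move=> _ X mX; rewrite setTI; exact: caratheodory_borel. Qed.

HB.instance Definition _ := Measure.copy outer_borel
  (measure_function_pushforward__canonical__measure_function_Measure
    (@lebesgue_measure_rV R d) id_meas).

Let boxes : set (set borel) := [set box I | I in setT].

Let boxesE : @measurable _ borel = <<s boxes >>.
Proof.
apply/seteqP; split; last first.
  apply: smallest_sub; first exact: sigma_algebra_measurable.
  by move=> _ [I _ <-]; exact: measurable_box.
have mid : measurable_fun setT (fun x : g_sigma_algebraType boxes => x : borel).
  apply: measurable_fun_rV => i.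
  apply: (measurability _ (RGenOInfty.measurableE R)).
  move=> _ [_ [c ->] <-]; rewrite setTI.
  rewrite [X in measurable X](_ : _ = \bigcup_n (box (Some
     (\row_j (if j == i then c else - n%:R), const_mx n%:R)) : set borel)).
    apply: bigcupT_measurable => n; apply: sub_sigma_algebra.
    by eexists.
  apply/seteqP; split=> x /=.
    rewrite in_itv/= andbT => cx.
    have [n xn] := coord_bounded x.
    exists n => //= j; rewrite !mxE; have xM := xn j.
    rewrite ltW; last by rewrite (le_lt_trans (ler_norm _)).
    have [->|_] := eqVneq j i; first by rewrite cx.
    by rewrite andbT ltrNl (le_lt_trans (ler_norm _))// normrN.
  by case=> n _ /(_ i) /=; rewrite mxE eqxx in_itv/= andbT => /andP[].
by move=> X mX; have := mid measurableT X mX; rewrite setTI.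
Qed.

(** Boxes form a generating family closed under intersection, both measures give them [box_volume],
    and cubes of finite measure exhaust the space. *)
Lemma mu_outer (X : set borel) : measurable X -> mu_rV R d X = outer X.
Proof.
move=> mX; rewrite -[outer X]/(outer_borel X).
apply: (measure_unique boxes (fun n : nat => box (Some
   (const_mx (- n%:R), const_mx n%:R))) boxesE) => //.
- move=> _ _ [I _ <-] [J _ <-].
  case: I => [[a b]|]; last first.
    by exists None => //; rewrite /box set0I.
  case: J => [[a' b']|]; last by exists None => //; rewrite /box setI0.
  exists (Some (\row_j Num.max (a 0 j) (a' 0 j), \row_j Num.min (b 0 j) (b' 0 j))) => //.
  apply/seteqP; split => x /=.
    move=> h; split=> i; have := h i; rewrite !mxE gt_max le_min;
     by move=> /andP[/andP[h1 h2] /andP[h3 h4]]; rewrite ?h1 ?h2 ?h3 ?h4.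
  by move=> [h h'] i; rewrite !mxE gt_max le_min; have /andP[-> ->] := h i;
   have /andP[-> ->] := h' i.
- by move=> n; eexists.
- apply/seteqP; split=> // x _.
  have [n xn] := coord_bounded x.
  exists n => //= j; rewrite !mxE; have xM := xn j.
  by move: xM; rewrite ltr_norml => /andP[-> /ltW].
- move=> _ [I _ <-]; rewrite -[RHS]/(outer (box I)) outer_box.
  exact: mu_box.
- move=> n; pose I := Some (const_mx (- n%:R) : 'rV[R]_d, const_mx n%:R : 'rV[R]_d).
  suff: (mu_rV R d (box I) < +oo)%E by [].
  by rewrite mu_box ltry.
Qed.

(** [G] is the intersection over [k] of the unions of covers whose volume is within [1/(k+1)] of the
    infimum. *)
Lemma outer_hull (X : set 'rV[R]_d) : (outer X < +oo)%E ->
  exists G : set borel, [/\ measurable G, X `<=` G & mu_rV R d G = outer X].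
Proof.
move=> Xoo.
have fX : outer X \is a fin_num.
  by rewrite ge0_fin_numE// lebesgue_outer_rV_ge0.
have /choice[F FP] (k : nat) : exists F : nat -> option ('rV[R]_d * 'rV[R]_d),
    X `<=` \bigcup_j box (F j) /\
    (\sum_(j <oo) box_volume (F j) < outer X + k.+1%:R^-1%:E)%E.
  have k0 : 0 < k.+1%:R^-1 :> R by rewrite invr_gt0.
  by have [_ [F XF <-] FX] := lb_ereal_inf_adherent k0 fX; exists F.
pose U k : set borel := \bigcup_j box (F k j).
have mU k : measurable (U k).
  by apply: bigcupT_measurable => j; exact: measurable_box.
have mG : measurable (\bigcap_k U k) by exact: bigcapT_measurable.
exists (\bigcap_k U k); split => //.
  by move=> x Xx k _; exact: (FP k).1.
apply/eqP; rewrite eq_le; apply/andP; split; last first.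
  rewrite (mu_outer mG); apply: le_lebesgue_outer_rV.
  by move=> x Xx k _; exact: (FP k).1.
apply/lee_addgt0Pr => e e0.
have [k ke] : exists k : nat, (k.+1%:R^-1 : R) < e.
  have := @cvg_harmonic R => /cvgrPdist_lt /(_ e e0) [k _ /(_ k) /=].
  by rewrite leqnn sub0r normrN ger0_norm// => /(_ isT) ke; exists k.
apply: (@le_trans _ _ (\sum_(j <oo) box_volume (F k j)))%E; last first.
  by rewrite (le_trans (ltW (FP k).2))// leeD2l// lee_fin ltW.
under eq_eseriesr do rewrite -mu_box.
apply: measure_sigma_subadditive => //.
- by move=> j; exact: measurable_box.
- by move=> x; apply.
Qed.

(** Random vectors are only Borel measurable, so [A] and [B] are replaced by Borel cores up to a
    null set. The core is [G] minus a null hull of [G \ A], where [G] is a hull of [A];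
    Caratheodory's condition tested on [G] makes [G \ A] null. *)
Lemma borel_approx (A : set 'rV[R]_d) : lebesgue_measurable_rV A ->
  (outer A < +oo)%E ->
  exists A0 N : set borel, [/\ measurable A0, A0 `<=` A, outer N = 0%E,
    A `<=` A0 `|` N & mu_rV R d A0 = outer A].
Proof.
move=> mA Aoo; have [G [mG AG GA]] := outer_hull Aoo.
have fA : outer A \is a fin_num.
  by rewrite ge0_fin_numE// lebesgue_outer_rV_ge0.
have GA0 : outer (G `\` A) = 0%E.
  have h : outer G = (outer A + outer (G `\` A))%E.
    by rewrite [LHS](mA G) -setDE; congr (outer _ + _)%E;
      apply/seteqP; split=> [x []//|x Ax]; split => //; exact: AG.
  move: h; rewrite -(mu_outer mG) GA; have := lebesgue_outer_rV_ge0 (G `\` A).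
  move: fA; case: (outer A) => // a _; case: (outer (G `\` A)) => //= r _.
  by rewrite -EFinD => -[/eqP]; rewrite -subr_eq0 opprD addrA subrr sub0r
    oppr_eq0 => /eqP ->.
have [|N [mN GN N0]] := @outer_hull (G `\` A); first by rewrite GA0.
exists (G `\` N), N; split.
- exact: measurableD.
- by move=> x [Gx Nx]; apply: contrapT => Ax; apply: Nx; exact: GN.
- by rewrite -mu_outer// N0.
- move=> x Ax; have [Nx|Nx] := pselect (N x); [by right|left; split => //].
  exact: AG.
- have -> : mu_rV R d (G `\` N) = (mu_rV R d G - mu_rV R d (G `&` N))%E.
    by apply: measureD => //=; rewrite GA.
  suff -> : mu_rV R d (G `&` N) = 0%E by rewrite sube0 GA.
  apply/eqP; rewrite eq_le measure_ge0 andbT -GA0 -N0.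
  by apply: le_measure; rewrite ?inE//; exact: measurableI.
Qed.

Lemma outer_translate (X : set 'rV[R]_d) (v : 'rV[R]_d) :
  outer (translate X v) = outer X.
Proof.
have le Y w : (outer (translate Y w) <= outer Y)%E.
  apply: le_ereal_inf_tmp => _ [F YF <-]; apply: ereal_inf_lbound.
  pose sh (I : option ('rV[R]_d * 'rV[R]_d)) :=
    if I is Some (a, b) then Some (a + w, b + w) else None.
  exists (sh \o F).
    move=> _ [x /YF[k _ Fx] <-]; exists k => //=.
    move: Fx; case: (F k) => [[a b]|]//= h i; rewrite !mxE.
    by rewrite ltrD2r lerD2r.
  apply: eq_eseriesr => k _ /=; case: (F k) => [[a b]|]//=.
  by congr EFin; apply: eq_bigr => i _; rewrite !mxE opprD addrACA subrr addr0.
apply/eqP; rewrite eq_le le/=.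
rewrite (le_trans _ (le (translate X v) (- v)))//.
apply: le_lebesgue_outer_rV => x Xx; exists (x + v); first by exists x.
by rewrite addrK.
Qed.

Lemma measurable_shift (v : 'rV[R]_d) :
  measurable_fun setT (fun x : borel => (x : 'rV[R]_d) + v : borel).
Proof.
apply: measurable_fun_rV => i; under eq_fun do rewrite mxE.
by apply: measurable_funD => //; exact: measurable_coord.
Qed.

Lemma mu_shift (X : set borel) (v : 'rV[R]_d) : measurable X ->
  mu_rV R d [set x | X ((x : 'rV[R]_d) + v)] = mu_rV R d X.
Proof.
move=> mX; rewrite !mu_outer//; last first.
  by rewrite -[X in measurable X]setTI; exact: measurable_shift.
rewrite -(outer_translate X (- v)); congr outer.
apply/seteqP; split => [x Xx|_ [x Xx <-]] /=; last by rewrite subrK.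
by exists (x + v) => //; rewrite addrK.
Qed.

End outer.

(** * Translation-invariant measures *)

Lemma measurable_preimage d1 d2 (T1 : measurableType d1) (T2 : measurableType d2)
    (f : T1 -> T2) (X : set T2) :
  measurable_fun setT f -> measurable X -> measurable [set x | X (f x)].
Proof. by move=> mf mX; rewrite -[X in measurable X]setTI; exact: mf. Qed.

Section prodm.
Context d1 d2 (T1 : measurableType d1) (T2 : measurableType d2) (R : realType).
Variable m1 : {sigma_finite_measure set T1 -> \bar R}.
Variable m2 : {sigma_finite_measure set T2 -> \bar R}.

Definition prod_meas : set (T1 * T2) -> \bar R := (m1 \x m2)%E.
HB.instance Definition _ := Measure.on prod_meas.

Let prod_meas_sigma_finite : sigma_finite setT prod_meas.
Proof.
have /sigma_finiteP[F [TF ndF Foo]] := sigma_finiteT m1.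
have /sigma_finiteP[G [TG ndG Goo]] := sigma_finiteT m2.
exists (fun n => F n `*` G n).
  rewrite -setXTT TF TG predeqE => -[x y]; split.
    move=> [/= [n _ Fnx] [k _ Gky]]; exists (maxn n k) => //; split.
    - by move: x Fnx; exact/subsetPset/ndF/leq_maxl.
    - by move: y Gky; exact/subsetPset/ndG/leq_maxr.
  by move=> [n _ []/= ? ?]; split; exists n.
move=> k; have [? ?] := Foo k; have [? ?] := Goo k.
split; first exact: measurableX.
by rewrite /prod_meas product_measure1E// lte_mul_pinfty// ge0_fin_numE.
Qed.
HB.instance Definition _ :=
  Measure_isSigmaFinite.Build _ _ _ prod_meas prod_meas_sigma_finite.

Definition prodm : {sigma_finite_measure set (T1 * T2)%type -> \bar R} := prod_meas.

Lemma prodmX (A : set T1) (B : set T2) : measurable A -> measurable B ->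
  prodm (A `*` B) = (m1 A * m2 B)%E.
Proof. exact: product_measure1E. Qed.

Lemma prodmE1 (W : set (T1 * T2))  : prodm W = (\int[m1]_x m2 [set y | W (x, y)])%E.
Proof. by apply: eq_integral => x _ /=; rewrite xsectionE. Qed.

Lemma prodmE2 (W : set (T1 * T2)) : measurable W ->
  prodm W = (\int[m2]_y m1 [set x | W (x, y)])%E.
Proof.
move=> mW; rewrite [LHS](@product_measure_unique _ _ _ _ _ m1 m2
    (m1 \x^ m2)%E)//.
  by apply: eq_integral => y _ /=; rewrite ysectionE.
by move=> A B mA mB; exact: product_measure2E.
Qed.

Lemma measurable_sec1 (W : set (T1 * T2)) x : measurable W -> measurable [set y | W (x, y)].
Proof. by move=> mW; have := measurable_xsection x mW; rewrite xsectionE. Qed.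

Lemma measurable_sec2 (W : set (T1 * T2)) y : measurable W -> measurable [set x | W (x, y)].
Proof. by move=> mW; have := measurable_ysection y mW; rewrite ysectionE. Qed.

Lemma measurable_msec1 (W : set (T1 * T2))  : measurable W ->
  measurable_fun setT (fun x => m2 [set y | W (x, y)]).
Proof.
move=> mW; have := measurable_fun_xsection m2 mW.
by apply: eq_measurable_fun => x _ /=; rewrite xsectionE.
Qed.

Lemma measurable_msec2 (W : set (T1 * T2))  : measurable W ->
  measurable_fun setT (fun y => m1 [set x | W (x, y)]).
Proof.
move=> mW; have := measurable_fun_ysection m1 mW.
by apply: eq_measurable_fun => y _ /=; rewrite ysectionE.
Qed.

End prodm.

Section invariant_measure.
Context disp (T : measurableType disp) (R : realType).
Variable m : {sigma_finite_measure set T -> \bar R}.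

(** Stated for bare operations so that the same lemmas serve the line ([leb_invariant]) and R^d
    ([mu_invariant]). *)
Record translation_invariant (zero : T) (add sub : T -> T -> T) : Prop := {
  ti_add : measurable_fun setT (fun p : T * T => add p.1 p.2) ;
  ti_sub : measurable_fun setT (fun p : T * T => sub p.1 p.2) ;
  ti_addsub : forall x z, add x (sub z x) = z ;
  ti_subadd : forall x y, sub (add x y) x = y ;
  ti_subaddr : forall x y, sub x (add x y) = sub zero y ;
  ti_addC : forall x y, add x y = add y x ;
  ti_m : forall X x, measurable X -> m [set y | X (add x y)] = m X }.

Variables (zero : T) (add sub : T -> T -> T).
Hypothesis ti : translation_invariant zero add sub.

Lemma measurable_add d' (T' : measurableType d') (f g : T' -> T) :
  measurable_fun setT f -> measurable_fun setT g ->
  measurable_fun setT (fun t => add (f t) (g t)).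
Proof.
by move=> mf mg; exact: (measurableT_comp (ti_add ti) (measurable_fun_pair mf mg)).
Qed.

Lemma measurable_sub d' (T' : measurableType d') (f g : T' -> T) :
  measurable_fun setT f -> measurable_fun setT g ->
  measurable_fun setT (fun t => sub (f t) (g t)).
Proof.
by move=> mf mg; exact: (measurableT_comp (ti_sub ti) (measurable_fun_pair mf mg)).
Qed.

(** The substitution [(x, y) -> (x, x + y)]: Fubini, and translation invariance on each slice. *)
Lemma prodm_shear (W : set (T * T)) : measurable W ->
  prodm m m W = (\int[m]_z m [set x | W (x, sub z x)])%E.
Proof.
move=> mW.
have mW' : measurable [set p : T * T | W (p.1, sub p.2 p.1)].
  apply: (measurable_preimage (f := fun p : T * T => (p.1, sub p.2 p.1))) => //.
  by apply: measurable_fun_pair => //; exact: measurable_sub.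
have := prodmE2 m m mW' => /= <-; rewrite !prodmE1.
apply: eq_integral => x _ /=.
rewrite -[RHS](ti_m ti x); last exact: (measurable_sec1 x mW').
by congr (m _); apply/seteqP; split => y /=; rewrite (ti_subadd ti).
Qed.

(* Weil's uniqueness argument for translation-invariant measures, applied to
   X |-> m (Li^-1 X). *)
Lemma invariant_unique (L Li : T -> T) (X Y : set T) :
  measurable_fun setT Li -> measurable X -> measurable Y ->
  (forall x y, Li (add (L y) x) = add (Li x) y) ->
  (m [set x | X (Li x)] * m Y = m [set x | Y (Li x)] *
     m [set y | X (sub zero y)])%E.
Proof.
move=> mLi mX mY LiL.
have mXL : measurable [set x | X (Li x)] by exact: measurable_preimage.
have mYL : measurable [set x | Y (Li x)] by exact: measurable_preimage.
have mD : measurable [set p : T * T | X (Li p.1) /\ Y (add (Li p.1) p.2)].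
  apply: measurableI.
    by apply: (measurable_preimage (f := fun p : T * T => Li p.1)) => //;
      exact: measurableT_comp.
  apply: (measurable_preimage (f := fun p : T * T => add (Li p.1) p.2)) => //.
  by apply: measurable_add => //; exact: measurableT_comp.
have mD' : measurable [set p : T * T | Y (Li p.1) /\ X (sub (Li p.1) p.2)].
  apply: measurableI.
    by apply: (measurable_preimage (f := fun p : T * T => Li p.1)) => //;
      exact: measurableT_comp.
  apply: (measurable_preimage (f := fun p : T * T => sub (Li p.1) p.2)) => //.
  by apply: measurable_sub => //; exact: measurableT_comp.
transitivity (prodm m m [set p : T * T | X (Li p.1) /\ Y (add (Li p.1) p.2)]).
  rewrite prodmE1 muleC -integral_cst// integral_mkcond.
  apply: eq_integral => x _; rewrite patchE; case: ifPn => [|].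
    rewrite inE /= => Xx; rewrite -[LHS](ti_m ti (Li x))//.
    by congr (m _); apply/seteqP; split => [y //|y []].
  rewrite notin_setE => Xx; rewrite -[LHS](measure0 m); congr (m _).
  by apply/seteqP; split => // y [].
rewrite (prodmE2 m m mD).
transitivity (prodm m m [set p : T * T | Y (Li p.1) /\ X (sub (Li p.1) p.2)]).
  rewrite (prodmE2 m m mD'); apply: eq_integral => y _ /=.
  (* For fixed [y], translating [x] by [L y] adds [y] to [Li x], which exchanges the two
     descriptions of the slice. *)
  rewrite -[RHS](ti_m ti (L y)); last exact: (measurable_sec2 y mD').
  congr (m _); apply/seteqP; split => x /=; rewrite LiL (ti_addC ti (Li x) y) (ti_subadd ti)//.
    by rewrite (ti_addC ti y) => -[].
  by rewrite (ti_addC ti y) => -[].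
rewrite prodmE1 muleC -integral_cst// [RHS]integral_mkcond.
apply: eq_integral => x _; rewrite patchE; case: ifPn => [|].
  rewrite inE /= => Yx.
  rewrite -[LHS](ti_m ti (Li x)); last exact: (measurable_sec1 x mD').
  by congr (m _); apply/seteqP; split => [y []|y] /=; rewrite (ti_subaddr ti).
rewrite notin_setE => Yx; rewrite -[RHS](measure0 m); congr (m _).
by apply/seteqP; split => // y [].
Qed.

(** [invariant_unique] for the identity map; the finite positive measure of [Y] can then be
    cancelled. *)
Lemma invariant_opp (X Y : set T) : measurable X -> measurable Y ->
  (0 < m Y < +oo)%E -> m [set y | X (sub zero y)] = m X.
Proof.
move=> mX mY /andP[Y0 Yoo].
have h := @invariant_unique id id X Y (@measurable_id _ _ setT) mX mY
   (fun x y => ti_addC ti y x).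
have fY : m Y \is a fin_num by rewrite ge0_fin_numE.
move: h; rewrite muleC => /eqP; rewrite -(fineK fY).
rewrite eq_le !lee_pmul2l ?lte_fin ?fine_gt0 ?Y0// -eq_le => /eqP.
exact: esym.
Qed.

Lemma invariant_refl (X Y : set T) z : measurable X -> measurable Y ->
  (0 < m Y < +oo)%E -> m [set x | X (sub z x)] = m X.
Proof.
move=> mX mY Yoo; rewrite -(ti_m ti z); last first.
  apply: (measurable_preimage (f := fun x => sub z x)) => //.
  exact: measurable_sub.
rewrite -(invariant_opp mX mY Yoo); congr (m _).
by apply/seteqP; split => x /=; rewrite (ti_subaddr ti).
Qed.

Lemma measurable_shear (W : set (T * T)) : measurable W ->
  measurable_fun setT (fun z => m [set x | W (x, sub z x)]).
Proof.
move=> mW; apply: (measurable_msec2 m (W := [set p | W (p.1, sub p.2 p.1)])).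
apply: (measurable_preimage (f := fun p : T * T => (p.1, sub p.2 p.1))) => //.
by apply: measurable_fun_pair => //; exact: measurable_sub.
Qed.

(** The Riesz functional: the convolution of the indicators of [A] and [B], integrated over [S] (see
    [corrE]). *)
Definition corr (A B S : set T) : \bar R :=
  prodm m m [set p | [/\ A p.1, B p.2 & S (add p.1 p.2)]].

Lemma measurable_corr (A B S : set T) :
  measurable A -> measurable B -> measurable S ->
  measurable [set p | [/\ A p.1, B p.2 & S (add p.1 p.2)]].
Proof.
move=> mA mB mS.
rewrite [X in measurable X](_ : _ = [set p : T * T | A p.1] `&`
  [set p | B p.2] `&` [set p | S (add p.1 p.2)]); last first.
  by apply/seteqP; split => p /= => [[]|[[]]].
apply: measurableI; first apply: measurableI.
- exact: (measurable_preimage (f := @fst T T)).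
- exact: (measurable_preimage (f := @snd T T)).
- by apply: (measurable_preimage (ti_add ti)).
Qed.

Lemma corrE (A B S : set T) :
  measurable A -> measurable B -> measurable S ->
  corr A B S = (\int[m]_(z in S) m [set x | A x /\ B (sub z x)])%E.
Proof.
move=> mA mB mS; rewrite /corr prodm_shear; last exact: measurable_corr.
rewrite [RHS]integral_mkcond.
apply: eq_integral => z _; rewrite patchE; case: ifPn => [|].
  rewrite inE => Sz; congr (m _).
  by apply/seteqP; split => x /=; rewrite (ti_addsub ti) => -[].
rewrite notin_setE => Sz; rewrite -[RHS](measure0 m); congr (m _).
by apply/seteqP; split => // x /=; rewrite (ti_addsub ti) => -[].
Qed.

End invariant_measure.

(** * The Riesz-Sobolev inequality on the line *)

Section real_line.
Context {R : realType}.
Local Notation leb := (leb R).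
Local Notation RT := (measurableTypeR R).

Definition add1 (x y : RT) : RT := (x : R) + (y : R).
Definition sub1 (x y : RT) : RT := (x : R) - (y : R).

Lemma leb_shift (X : set RT) (x : RT) : measurable X ->
  leb [set y : RT | X (add1 x y)] = leb X.
Proof.
move=> mX.
have mf : measurable_fun setT (add1 x).
  exact: measurable_funD.
pose m' := measure_function_pushforward__canonical__measure_function_Measure leb mf.
suff -> : leb X = m' X by [].
apply: (lebesgue_measure_unique (mu := m')) => // _ [[a b] _ <-] /=.
rewrite lebesgue_measure_itv/= /pushforward.
rewrite [X in leb X](_ : _ = `]a - x, b - x]%classic).
  rewrite [RHS]lebesgue_measure_itv/= !lte_fin ltrBDr subrK.
  by case: ifPn => // _; rewrite -EFinB; congr EFin; ring.
by apply/seteqP; split => y /=; rewrite !in_itv/= ltrBlDl lerBrDl.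
Qed.

Lemma leb_invariant :
  @translation_invariant _ RT R leb (0 : R) add1 sub1.
Proof.
split; rewrite /add1 /sub1.
- exact: measurable_funD.
- exact: measurable_funB.
- by move=> x z; rewrite addrC subrK.
- by move=> x y; rewrite addrC addKr.
- by move=> x y; rewrite opprD addrA subrr.
- by move=> x y; rewrite addrC.
- by move=> X x mX; exact: leb_shift.
Qed.

Definition lower_set (L : set RT) := forall x y : R, x <= y -> L y -> L x.

(** Intermediate values: the measure of the part of [A] below [p] is nondecreasing and 1-Lipschitz
    in [p], and runs from 0 to [a]. *)
Lemma lower_set_measure (A : set RT) (a t : R) : measurable A ->
  leb A = a%:E -> 0 <= t <= a ->
  exists L, [/\ measurable L, lower_set L & leb (A `&` L) = t%:E].
Proof.
move=> mA Aa /andP[t0 ta].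
have [->|tNa] := eqVneq t a.
  by exists setT; split => //; rewrite setIT.
have [->|tN0] := eqVneq t 0.
  by exists set0; split => //; rewrite setI0 measure0.
have {tNa ta} ta : t < a by rewrite lt_neqAle tNa.
have {tN0} t0 : 0 < t by rewrite lt_neqAle eq_sym tN0.
pose H (p : R) : set RT := A `&` `]-oo, p]%classic.
have mH p : measurable (H p) by exact: measurableI.
have HA p : (leb (H p) <= a%:E)%E.
  by rewrite -Aa; apply: le_measure; rewrite ?inE//; exact: subIsetl.
have Hf p : leb (H p) \is a fin_num.
  by rewrite ge0_fin_numE// (le_lt_trans (HA p))// ltry.
pose g p := fine (leb (H p)).
have gE p : (g p)%:E = leb (H p) by rewrite fineK.
have glip (p q : R) : p <= q -> g q <= g p + (q - p).
  move=> pq; rewrite -lee_fin EFinD !gE.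
  apply: (@le_trans _ _ (leb (H p `|` `]p, q]%classic))).
    apply: le_measure; rewrite ?inE//; first exact: measurableU.
    move=> x [Ax] /=; rewrite !in_itv/= => xq.
    by have [xp|xp] := leP x p; [left; split => //=; rewrite in_itv|right].
  apply: (le_trans (measureU2 _ _ _)) => //.
  rewrite leeD2l//= [X in (X <= _)%E]lebesgue_measure_itv/= lte_fin.
  by case: ifPn => _; rewrite ?EFinB// -EFinB lee_fin subr_ge0.
have gmono (p q : R) : p <= q -> g p <= g q.
  move=> pq; rewrite -lee_fin !gE; apply: le_measure; rewrite ?inE//.
  by apply: setIS => x /=; rewrite !in_itv/= => /le_trans; apply.
have ge0 p : 0 <= g p by rewrite fine_ge0.
have lowP : exists p, g p < t.
  have /fine_cvgP[_ /cvgrPdist_lt /(_ t t0) [n _ /(_ n (leqnn n)) /=]] :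
      leb \o (fun n : nat => H (- n%:R)) @ \oo --> (0 : R)%:E.
    rewrite -[X in _ --> X](measure0 leb).
    rewrite (_ : set0 = \bigcap_n H (- n%:R)); last first.
      apply/esym/seteqP; split => // x Hx.
      have := archi_boundP (normr_ge0 x); have [_ /=] := Hx (Num.bound `|x|) I.
      rewrite in_itv/=; move: (Num.bound _) => k h1.
      by have := ler_norm (- x); rewrite normrN; move: h1; lra.
    apply: nonincreasing_cvg_mu => //.
    - by have := Hf (- 0%:R); rewrite ge0_fin_numE.
    - exact: bigcapT_measurable.
    move=> m n mn; apply/subsetPset; apply: setIS => x /=.
    by rewrite !in_itv/= => /le_trans; apply; rewrite lerN2 ler_nat.
  rewrite sub0r normrN ger0_norm; last exact: ge0.
  by exists (- n%:R).
have upP : exists p, t < g p.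
  have at0 : 0 < a - t by rewrite subr_gt0.
  have /fine_cvgP[_ /cvgrPdist_lt /(_ _ at0) [n _ /(_ n (leqnn n)) /=]] :
      leb \o (fun n : nat => H n%:R) @ \oo --> a%:E.
    rewrite -Aa (_ : A = \bigcup_n H n%:R); last first.
      apply/seteqP; split => [x Ax|x [n _ []//]].
      exists (Num.bound `|x|) => //; split => //=; rewrite in_itv/=.
      by rewrite (le_trans (ler_norm x))// ltW// archi_boundP.
    apply: nondecreasing_cvg_mu => //; first exact: bigcupT_measurable.
    move=> m n mn; apply/subsetPset; apply: setIS => x /=.
    by rewrite !in_itv/= => /le_trans; apply; rewrite ler_nat.
  move=> /(le_lt_trans (ler_norm _)) h; exists n%:R.
  by rewrite -/(g n%:R) in h; lra.
pose P := [set p | g p <= t].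
have P0 : P !=set0 by have [p /ltW] := lowP; exists p.
have Pub : has_ubound P.
  have [q tq] := upP; exists q => p /= gpt; rewrite leNgt; apply/negP => qp.
  by have := gmono _ _ (ltW qp); rewrite leNgt (le_lt_trans gpt).
pose p0 := sup P.
have gp0 : g p0 = t.
  (* By [glip], a strict inequality at [p0] in either direction persists nearby, against [p0] being
     the supremum of [P]. *)
  apply/eqP; rewrite eq_le !leNgt; apply/andP; split; apply/negP => h.
    have dl0 : 0 < (g p0 - t) / 2 by lra.
    have [p Pp hp] := sup_adherent dl0 (conj P0 Pub).
    have gpt : g p <= t by exact: Pp.
    rewrite -/p0 in hp; have := glip _ _ (ub_le_sup Pub Pp); rewrite -/p0; lra.
  have : P (p0 + (t - g p0) / 2).
    by have := glip p0 (p0 + (t - g p0) / 2); rewrite /P/=; lra.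
  by move=> /(ub_le_sup Pub); rewrite -/p0; lra.
exists `]-oo, p0]%classic; split => //.
  by move=> x y xy /=; rewrite !in_itv/=; exact: le_trans.
by rewrite -gp0 gE.
Qed.

Local Notation corr1 := (corr leb add1).

Lemma leb_refl (X : set RT) (z : RT) : measurable X ->
  leb [set x | X (sub1 z x)] = leb X.
Proof.
move=> mX; apply: (invariant_refl leb_invariant (Y := `]0, 1]%classic)) => //.
by rewrite [leb _]lebesgue_measure_itv/= lte01 oppr0 adde0 lte_fin ltr01 ltry.
Qed.

(* With |A `&` L| = t and |B `\` V| = t for lower sets L and V, the slice at z of
   the pairs with x in L or y not in V is cut out by the two lower sets L and
   {x | z - x not in V}; one of them contains the other, so the slice has measure
   at most t. *)
Lemma corr1_le (A B S : set RT) (a b t : R) :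
  measurable A -> measurable B -> measurable S ->
  leb A = a%:E -> leb B = b%:E -> 0 <= t <= a -> t <= b ->
  (corr1 A B S <= t%:E * leb S + ((a - t) * (b - t))%:E)%E.
Proof.
move=> mA mB mS Aa Bb ta tb.
have t0 : 0 <= t by case/andP: ta.
have [L [mL lL AL]] := lower_set_measure mA Aa ta.
have [|V [mV lV BV]] := lower_set_measure mB Bb (t := b - t).
  by rewrite subr_ge0 tb lerBlDr lerDl.
have AL' : leb (A `\` L) = (a - t)%:E.
  have -> : leb (A `\` L) = (leb A - leb (A `&` L))%E.
    by apply: measureD => //=; rewrite Aa ltry.
  by rewrite Aa AL.
have BV' : leb (B `\` V) = t%:E.
  have -> : leb (B `\` V) = (leb B - leb (B `&` V))%E.
    by apply: measureD => //=; rewrite Bb ltry.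
  by rewrite Bb BV -EFinB opprB addrC subrK.
pose W := [set p : RT * RT | [/\ A p.1, B p.2 & S (add1 p.1 p.2)]].
have mW : measurable W by exact: (measurable_corr leb_invariant).
pose D := [set p : RT * RT | L p.1 \/ ~ V p.2].
have mD : measurable D.
  apply: measurableU; first exact: (measurable_preimage (f := @fst RT RT)).
  apply: measurableC; exact: (measurable_preimage (f := @snd RT RT)).
have mWD : measurable (W `&` D) by exact: measurableI.
rewrite /corr -/W.
have -> : W = (W `&` D) `|` (W `&` ~` D) by rewrite -setIUr setUv setIT.
apply: (le_trans (measureU2 _ _ _)) => //.
  by apply: measurableI => //; exact: measurableC.
apply: leeD => /=.
  rewrite (prodm_shear leb_invariant)// -integral_cst// [leRHS]integral_mkcond.
  apply: ge0_le_integral => //.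
  - exact: (measurable_shear leb_invariant).
  - by apply/(measurable_restrictT _ _).1 => //; exact: measurable_cst.
  move=> z _; rewrite patchE; case: ifPn => [|]; last first.
    rewrite notin_setE => Sz; rewrite [X in leb X](_ : _ = set0) ?measure0//.
    apply/seteqP; split=> // x /= [[_ _]].
    by rewrite /add1 /sub1 (addrC (x : R)) subrK.
  rewrite inE => Sz.
  have mrefl X : measurable X -> measurable [set x : RT | X (sub1 z x)].
    apply: (measurable_preimage (f := fun x => sub1 z x)).
    exact: (measurable_sub leb_invariant).
  have [LZ|/existsNP[x0 /not_implyP[Lx0 /contrapT Vx0]]] :=
      pselect (forall x, L x -> ~ V (sub1 z x)).
    rewrite -BV' -(leb_refl z); last exact: measurableD.
    apply: le_measure; rewrite ?inE.
    - exact: (measurable_preimage (f := fun x => (x, sub1 z x))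
        (measurable_fun_pair (@measurable_id _ _ _)
           (measurable_sub leb_invariant (measurable_cst z) (@measurable_id _ _ _)))).
    - exact: (mrefl _ (measurableD mB mV)).
    - by move=> x /= [[_ Bx _] [/LZ|]].
  rewrite -AL; apply: le_measure; rewrite ?inE.
  - exact: (measurable_preimage (f := fun x => (x, sub1 z x))
        (measurable_fun_pair (@measurable_id _ _ _)
           (measurable_sub leb_invariant (measurable_cst z) (@measurable_id _ _ _)))).
  - exact: measurableI.
  move=> x /= [[Ax _ _] [Lx|Vx]]; split => //.
  have [xx0|x0x] := leP (x : R) x0; first exact: lL xx0 Lx0.
  by case: Vx; apply: lV Vx0; rewrite /sub1 lerB// ltW.
(* The pairs outside [D] have [x] outside [L] and [y] in [V]: a rectangle of area
   [(a - t)(b - t)]. *)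
apply: (@le_trans _ _ (prodm leb leb ((A `\` L) `*` (B `&` V)))).
  apply: le_measure; rewrite ?inE.
  - by apply: measurableI => //; exact: measurableC.
  - by apply: measurableX; [exact: measurableD|exact: measurableI].
  move=> [x y] /= [[Ax By _] /not_orP[Lx /contrapT Vy]]; split; split => //.
by rewrite prodmX ?AL' ?BV//; [exact: measurableD|exact: measurableI].
Qed.

(** The length is an extended real because a section of [S] may have infinite measure; comparing
    [2|x|] with it avoids halving an extended real. *)
Definition centered (e : \bar R) : set RT := [set x : R | (`|x| *+ 2)%:E < e]%E.

Lemma centeredE (e : R) : centered e%:E = `]- (e / 2), e / 2[%classic.
Proof.
by apply/seteqP; split => x;
  rewrite /centered/= in_itv/= lte_fin -ltr_norml ltr_pdivlMr// mulr_natr.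
Qed.

Lemma measurable_centered e : measurable (centered e).
Proof.
case: e => [r| |]; first by rewrite centeredE.
  by rewrite (_ : centered _ = setT)//; apply/seteqP; split => x //= _; exact: ltry.
by rewrite (_ : centered _ = set0)//; apply/seteqP; split => x //=; rewrite ltNge leNye.
Qed.

Lemma leb_centered e : (0 <= e)%E -> leb (centered e) = e.
Proof.
case: e => [r| |]//; rewrite ?lee_fin => r0.
  rewrite centeredE [LHS]lebesgue_measure_itv/= lte_fin.
  case: ifPn => h; first by rewrite -EFinB; congr EFin; lra.
  by congr EFin; lra.
rewrite (_ : centered _ = setT); last first.
  by apply/seteqP; split => x //= _; exact: ltry.
rewrite (_ : setT = [set` `]-oo, +oo[]); last by rewrite set_itvNyy.
by rewrite [LHS]lebesgue_measure_itv.
Qed.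

Lemma le_centered e f : (e <= f)%E -> centered e `<=` centered f.
Proof. by move=> ef x /= /lt_le_trans; apply. Qed.

Lemma leb_itv_ge (X : set RT) (u v : R) : measurable X ->
  `]u, v[%classic `<=` X -> ((v - u)%:E <= leb X)%E.
Proof.
move=> mX uX; apply: (@le_trans _ _ (leb `]u, v[%classic)); last first.
  by apply: le_measure; rewrite ?inE.
rewrite [leRHS]lebesgue_measure_itv/= lte_fin.
by case: ifPn => h; rewrite ?EFinB// lee_fin; lra.
Qed.

(* The condition on t makes it optimal in corr1_le. *)
Lemma corr1_centered_ge (a b s t : R) : 0 <= t -> t <= a -> t <= b -> 0 <= s ->
  (s = a + b - 2 * t \/ t = a /\ s + a <= b \/ t = b /\ s + b <= a) ->
  ((t * s + (a - t) * (b - t))%:E <=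
    corr1 (centered a%:E) (centered b%:E) (centered s%:E))%E.
Proof.
move=> t0 ta tb s0 h.
have mc := measurable_centered.
(* [p] cuts length [t] off the left end of the first interval and [q] cuts length [t] off the right
   end of the second: the half-lines for which [corr1_le] is sharp. *)
pose p := t - a / 2; pose q := b / 2 - t.
pose W := [set r : RT * RT | [/\ centered a%:E r.1, centered b%:E r.2 &
  centered s%:E (add1 r.1 r.2)]].
have mW : measurable W by exact: (measurable_corr leb_invariant).
pose D := [set r : RT * RT | `]-oo, p[%classic r.1 \/ `]q, +oo[%classic r.2].
have mD : measurable D.
  apply: measurableU; first exact: (measurable_preimage (f := @fst RT RT)).
  exact: (measurable_preimage (f := @snd RT RT)).
have mWD : measurable (W `&` D) by exact: measurableI.
have mWD' : measurable (W `&` ~` D).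
  by apply: measurableI => //; exact: measurableC.
have sliceE (z x : R) : - (s / 2) < z < s / 2 -> - (a / 2) < x < a / 2 ->
    - (b / 2) < z - x < b / 2 -> x < p \/ q < z - x ->
    (W `&` D) ((x : RT), sub1 z x).
  rewrite /W /D /= !centeredE /= /add1 /sub1 (addrC x) subrK !in_itv/= andbT.
  by move=> -> -> ->.
have : (corr1 (centered a%:E) (centered b%:E) (centered s%:E) =
        prodm leb leb (W `&` D) + prodm leb leb (W `&` ~` D))%E.
  rewrite /corr -/W -measureU//.
    by rewrite -setIUr setUv setIT.
  by rewrite setIACA setICr setI0.
move=> ->; rewrite EFinD; apply: leeD.
  rewrite (prodm_shear leb_invariant)//.
  have -> : (t * s)%:E = (\int[leb]_z ((cst t%:E) \_ (centered s%:E)) z)%E.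
    by rewrite -integral_mkcond integral_cst//= leb_centered.
  apply: ge0_le_integral => //.
  - by move=> z _; rewrite patchE; case: ifP => // _; rewrite lee_fin.
  - by apply/(measurable_restrictT _ _).1 => //; exact: measurable_cst.
  - exact: (measurable_shear leb_invariant).
  move=> z _; rewrite patchE; case: ifPn => [|]; last by rewrite measure_ge0.
  rewrite inE centeredE /= in_itv/= => zs.
  have mS : measurable [set x : RT | (W `&` D) (x, sub1 z x)].
    exact: (measurable_preimage (f := fun x => (x, sub1 z x))
        (measurable_fun_pair (@measurable_id _ _ _)
           (measurable_sub leb_invariant (measurable_cst z) (@measurable_id _ _ _)))).
  (* []-a/2, p[] and []z - b/2, z - q[] both have length [t]; the position of [z] relative to
     [p + q] decides which of them is shown to lie in the slice. *)
  have [zp|pz] := leP z (p + q).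
    have -> : t = p - - (a / 2) by rewrite /p; lra.
    apply: leb_itv_ge => // x /=; rewrite in_itv/= => xp.
    by apply: sliceE => //; [..|left]; rewrite /p /q in zp xp *; lra.
  have -> : t = (z - q) - (z - b / 2) by rewrite /q; lra.
  apply: leb_itv_ge => // x /=; rewrite in_itv/= => xp.
  by apply: sliceE => //; [..|right]; rewrite /p /q in pz xp *; lra.
(* If the product is nonzero then [s = a + b - 2t], and all sums from the rectangle []p,
   a/2[ x ]-b/2, q[] fall in []-s/2, s/2[]. *)
have [h2|h2] := eqVneq ((a - t) * (b - t)) 0; first by rewrite h2 measure_ge0.
have hs : s = a + b - 2 * t.
  by case: h => [//|[[th _]|[th _]]]; move: h2; rewrite th subrr ?mulr0 ?mul0r eqxx.
apply: (@le_trans _ _ (prodm leb leb (`]p, a / 2[%classic `*` `]- (b / 2), q[%classic))).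
  rewrite prodmX// [X in (_ <= X * _)%E]lebesgue_measure_itv/=.
  rewrite [X in (_ <= _ * X)%E]lebesgue_measure_itv/= !lte_fin.
  case: ifPn => h3; case: ifPn => h4;
    rewrite -?EFinB -?EFinM ?mul0e ?mule0 ?lee_fin /p /q; move: h3 h4; rewrite /p /q;
    nra.
apply: le_measure; rewrite ?inE//; first exact: measurableX.
move=> [x y] /=; rewrite !in_itv/= /W /D/= !centeredE/= /add1 !in_itv/= andbT.
rewrite /p /q hs => -[xp yq]; split; first by split; lra.
by case; lra.
Qed.

(** [corr1_le] and [corr1_centered_ge] meet at [t = min(a, b, (a + b - s)/2)]. When [S] has measure
    at least [a + b], [t = 0] works, and an interval of length [a + b] already attains the bound
    [ab]. *)
Lemma corr1_rearrangement (A B S : set RT) :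
  measurable A -> measurable B -> measurable S ->
  (leb A < +oo)%E -> (leb B < +oo)%E ->
  (corr1 A B S <= corr1 (centered (leb A)) (centered (leb B))
     (centered (leb S)))%E.
Proof.
move=> mA mB mS Aoo Boo.
have mc := measurable_centered.
have fA : leb A \is a fin_num by rewrite ge0_fin_numE.
have fB : leb B \is a fin_num by rewrite ge0_fin_numE.
pose a := fine (leb A); pose b := fine (leb B).
have Aa : leb A = a%:E by rewrite fineK.
have Bb : leb B = b%:E by rewrite fineK.
have a0 : 0 <= a by rewrite fine_ge0.
have b0 : 0 <= b by rewrite fine_ge0.
rewrite Aa Bb.
have [Sab|Sab] := leP ((a + b)%:E)%E (leb S).
  apply: (@le_trans _ _ (0%:E * leb S + ((a - 0) * (b - 0))%:E)%E).
    by apply: corr1_le => //; rewrite lexx.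
  rewrite mul0e add0e (@le_trans _ _ (corr1 (centered a%:E) (centered b%:E)
     (centered (a + b)%:E)))//.
    apply: le_trans (corr1_centered_ge (t := 0) _ _ _ _ _) => //.
    - by rewrite mul0r add0r.
    - exact: addr_ge0.
    - by left; lra.
  apply: le_measure; rewrite ?inE; [exact: (measurable_corr leb_invariant)..|].
  by move=> [x y] [] /= ? ? h; split => //; exact: le_centered Sab _ h.
have fS : leb S \is a fin_num by rewrite ge0_fin_numE// (lt_le_trans Sab)// leey.
pose s := fine (leb S).
have Ss : leb S = s%:E by rewrite fineK.
have s0 : 0 <= s by rewrite fine_ge0.
rewrite Ss; move: Sab; rewrite Ss lte_fin => sab.
suff [t [t0 ta tb h]] : exists t, [/\ 0 <= t, t <= a, t <= b &
    s = a + b - 2 * t \/ t = a /\ s + a <= b \/ t = b /\ s + b <= a].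
  apply: le_trans (corr1_centered_ge t0 ta tb s0 h).
  apply: (le_trans (corr1_le mA mB mS Aa Bb _ tb)); first by rewrite t0.
  by rewrite Ss -EFinM -EFinD.
have [h1|h1] := leP (s + a) b; first by exists a; split => //; [lra|right;left].
have [h2|h2] := leP (s + b) a; first by exists b; split => //; [lra|right;right].
by exists ((a + b - s) / 2); split; [lra..|left; lra].
Qed.

End real_line.

(** * Steiner symmetrization *)

Section vector_group.
Context {R : realType} {d : nat}.
Local Notation V := (borel_rV R d).

Definition addV (x y : V) : V := (x : 'rV[R]_d) + (y : 'rV[R]_d).
Definition subV (x y : V) : V := (x : 'rV[R]_d) - (y : 'rV[R]_d).

Lemma measurable_fun_addV disp (T : measurableType disp) (f g : T -> V) :
  measurable_fun setT f -> measurable_fun setT g ->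
  measurable_fun setT (fun t => addV (f t) (g t)).
Proof.
move=> mf mg; apply: measurable_fun_rV => i.
under eq_fun do rewrite mxE.
by apply: measurable_funD; apply: (measurableT_comp (measurable_coord i)).
Qed.

Lemma measurable_fun_subV disp (T : measurableType disp) (f g : T -> V) :
  measurable_fun setT f -> measurable_fun setT g ->
  measurable_fun setT (fun t => subV (f t) (g t)).
Proof.
move=> mf mg; apply: measurable_fun_rV => i.
under eq_fun do rewrite !mxE.
by apply: measurable_funB; apply: (measurableT_comp (measurable_coord i)).
Qed.

Lemma mu_invariant :
  @translation_invariant _ V R (mu_rV R d) (0 : 'rV[R]_d) addV subV.
Proof.
split; rewrite /addV /subV.
- exact: measurable_fun_addV.
- exact: measurable_fun_subV.
- by move=> x z; rewrite addrC subrK.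
- by move=> x y; rewrite addrAC subrr add0r.
- by move=> x y; rewrite opprD addrA subrr.
- by move=> x y; rewrite addrC.
- move=> X x mX; rewrite -(mu_shift (x : 'rV[R]_d) mX); congr (mu_rV R d _).
  by apply/seteqP; split => y /=; rewrite addrC.
Qed.

Definition corrV (A B S : set V) : \bar R := corr (mu_rV R d) addV A B S.

End vector_group.

Section steiner.
Context {R : realType} {d : nat}.
Local Notation leb := (leb R).
Local Notation RT := (measurableTypeR R).
Local Notation V := (borel_rV R d).
Local Notation V1 := (borel_rV R d.+1).
Implicit Types A B S : set V1.

Definition sec A (y : V) : set RT := [set r | A (vcons (y, r))].

Lemma measurable_sec A y : measurable A -> measurable (sec A y).
Proof.
move=> mA.
exact: (measurable_sec1 y (measurable_preimage (@measurable_vcons R d) mA)).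
Qed.

Lemma measurable_leb_sec A : measurable A ->
  measurable_fun setT (fun y => leb (sec A y)).
Proof.
move=> mA.
exact: (measurable_msec1 leb (measurable_preimage (@measurable_vcons R d) mA)).
Qed.

Lemma mu_sec A : mu_rV R d.+1 A = (\int[mu_rV R d]_y leb (sec A y))%E.
Proof. by rewrite muS [LHS](prodmE1 (mu_rV R d) leb). Qed.

Lemma integral_muS (h : V1 -> \bar R) : measurable_fun setT h ->
  (forall x, 0 <= h x)%E ->
  (\int[mu_rV R d.+1]_x h x = \int[mu_rV R d]_y \int[leb]_r h (vcons (y, r)))%E.
Proof.
move=> mh h0.
transitivity (\int[prodm (mu_rV R d) leb]_p h (vcons p))%E.
  rewrite /mu_rV !unlock.
  by rewrite [LHS](ge0_integral_pushforward (@measurable_vcons R d)).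
rewrite [LHS](fubini_tonelli1 (fun p => h (vcons p)))//.
apply: measurableT_comp => //; exact: measurable_vcons.
Qed.

Lemma vconsD (x y : V) (r s : RT) :
  addV (vcons (x, r)) (vcons (y, s)) = vcons (addV x y, add1 r s).
Proof.
by apply/rowP => i; rewrite /addV /add1 !mxE; case: unliftP => //= j _; rewrite mxE.
Qed.

(** The correlation set with coordinates regrouped, base points before fibre coordinates, so that
    its sections are one-dimensional correlation sets. *)
Let fibre A B S : set ((V * V) * (RT * RT)) :=
  [set p | [/\ A (vcons (p.1.1, p.2.1)), B (vcons (p.1.2, p.2.2)) &
               S (vcons (addV p.1.1 p.1.2, add1 p.2.1 p.2.2))]].

Let measurable_fibre A B S : measurable A -> measurable B -> measurable S ->
  measurable (fibre A B S).
Proof.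
move=> mA mB mS.
rewrite [X in measurable X](_ : _ =
  [set p : ((V * V) * (RT * RT)) | A (vcons (p.1.1, p.2.1))] `&`
  [set p : ((V * V) * (RT * RT)) | B (vcons (p.1.2, p.2.2))] `&`
  [set p : ((V * V) * (RT * RT)) | S (vcons (addV p.1.1 p.1.2, add1 p.2.1 p.2.2))]);
  last first.
  by apply/seteqP; split => p /= => [[]|[[]]].
have m11 : measurable_fun setT (fun p : ((V * V) * (RT * RT)) => p.1.1).
  exact: measurableT_comp.
have m12 : measurable_fun setT (fun p : ((V * V) * (RT * RT)) => p.1.2).
  exact: measurableT_comp.
have m21 : measurable_fun setT (fun p : ((V * V) * (RT * RT)) => p.2.1).
  exact: measurableT_comp.
have m22 : measurable_fun setT (fun p : ((V * V) * (RT * RT)) => p.2.2).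
  exact: measurableT_comp.
apply: measurableI; first apply: measurableI.
- apply: (measurable_preimage (f := fun p : ((V * V) * (RT * RT)) =>
    vcons (p.1.1, p.2.1))) => //.
  by apply: (measurableT_comp (@measurable_vcons R d)); exact: measurable_fun_pair.
- apply: (measurable_preimage (f := fun p : ((V * V) * (RT * RT)) =>
    vcons (p.1.2, p.2.2))) => //.
  by apply: (measurableT_comp (@measurable_vcons R d)); exact: measurable_fun_pair.
- apply: (measurable_preimage (f := fun p : ((V * V) * (RT * RT)) =>
    vcons (addV p.1.1 p.1.2, add1 p.2.1 p.2.2))) => //.
  apply: (measurableT_comp (@measurable_vcons R d)); apply: measurable_fun_pair.
    exact: measurable_fun_addV.
  exact: (measurable_add leb_invariant).
Qed.

Let corr1_sec A B S (p : V * V) : \bar R :=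
  corr leb add1 (sec A p.1) (sec B p.2) (sec S (addV p.1 p.2)).

Let measurable_corr1_sec A B S :
  measurable A -> measurable B -> measurable S ->
  measurable_fun setT (corr1_sec A B S).
Proof.
move=> mA mB mS.
exact: (measurable_msec1 (prodm leb leb) (measurable_fibre mA mB mS)).
Qed.

Lemma corrV_fibre A B S : measurable A -> measurable B -> measurable S ->
  (corrV A B S = \int[mu_rV R d]_x \int[mu_rV R d]_y corr1_sec A B S (x, y))%E.
Proof.
move=> mA mB mS; rewrite /corrV /corr prodmE1.
have mW := measurable_corr (@mu_invariant R d.+1) mA mB mS.
rewrite integral_muS; last 2 first.
- exact: (measurable_msec1 (mu_rV R d.+1) mW).
- by move=> x; exact: measure_ge0.
apply: eq_integral => x _.
pose F (p : RT * V) : \bar R :=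
  leb [set s : RT | fibre A B S ((x, p.2), (p.1, s))].
transitivity (\int[leb]_r \int[mu_rV R d]_y F (r, y))%E.
  apply: eq_integral => r _; rewrite mu_sec; apply: eq_integral => y _.
  by congr (leb _); apply/seteqP; split => s; rewrite /sec/= vconsD.
rewrite (fubini_tonelli F).
- by apply: eq_integral => y _; rewrite /corr1_sec /corr/= prodmE1.
- apply: (measurable_msec1 leb (W := [set q : (RT * V) * RT |
    fibre A B S ((x, q.1.2), (q.1.1, q.2))])).
  apply: (measurable_preimage (f := fun q : (RT * V) * RT => ((x, q.1.2), (q.1.1, q.2)))).
    by apply: measurable_fun_pair; apply: measurable_fun_pair => //;
      exact: measurableT_comp.
  exact: measurable_fibre.
- by move=> p; exact: measure_ge0.
Qed.

Definition steiner A : set V1 :=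
  [set x | centered (leb (sec A (vtail x))) (vhead x)].

Lemma sec_steiner A y : sec (steiner A) y = centered (leb (sec A y)).
Proof.
apply/seteqP; split => r; rewrite /sec /steiner/=.
  by have [-> ->] := vconsK (y, r).
by have [-> ->] := vconsK (y, r).
Qed.

Lemma measurable_steiner A : measurable A -> measurable (steiner A).
Proof.
move=> mA; rewrite /steiner /centered/= -[X in measurable X]setTI.
apply: measurable_lte => //.
  have mh : measurable_fun setT (fun x : V1 => `|vhead x : R|).
    by apply: measurableT_comp => //; exact: measurable_vhead.
  by apply/measurable_EFinP; exact: (measurable_funD mh mh).
by apply: (measurableT_comp (measurable_leb_sec mA)); exact: measurable_vtail.
Qed.

Lemma mu_steiner A : measurable A -> mu_rV R d.+1 (steiner A) = mu_rV R d.+1 A.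
Proof.
move=> mA; rewrite !mu_sec; apply: eq_integral => y _.
by rewrite sec_steiner leb_centered.
Qed.

(** [corr1_rearrangement] applied on every pair of fibres. It asks for sections of finite measure,
    which later follow from boundedness. *)
Lemma corrV_steiner A B S : measurable A -> measurable B -> measurable S ->
  (forall y, leb (sec A y) < +oo)%E -> (forall y, leb (sec B y) < +oo)%E ->
  (corrV A B S <= corrV (steiner A) (steiner B) (steiner S))%E.
Proof.
move=> mA mB mS Aoo Boo.
have mA' := measurable_steiner mA.
have mB' := measurable_steiner mB.
have mS' := measurable_steiner mS.
rewrite (corrV_fibre mA mB mS) (corrV_fibre mA' mB' mS').
apply: ge0_le_integral; first exact: measurableT.
- by move=> x _; apply: integral_ge0 => y _; exact: measure_ge0.
- apply: (measurable_fun_fubini_tonelli_F (corr1_sec A B S)).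
    exact: measurable_corr1_sec.
  by move=> p; exact: measure_ge0.
- apply: (measurable_fun_fubini_tonelli_F (corr1_sec (steiner A) (steiner B) (steiner S))).
    exact: measurable_corr1_sec.
  by move=> p; exact: measure_ge0.
move=> x _; apply: ge0_le_integral; first exact: measurableT.
- by move=> y _; exact: measure_ge0.
- exact: (measurableT_comp (measurable_corr1_sec mA mB mS) (measurable_pair1 x)).
- exact: (measurableT_comp (measurable_corr1_sec mA' mB' mS') (measurable_pair1 x)).
move=> y _; rewrite /corr1_sec !sec_steiner.
by apply: corr1_rearrangement => //; exact: measurable_sec.
Qed.

End steiner.

(** * Balls and reflections *)

Section euclidean.
Context {R : realType}.
Implicit Types d : nat.

Definition dotp d (x y : 'rV[R]_d) : R := \sum_i x 0 i * y 0 i.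
(** Euclidean balls, whereas the topology of row vectors comes from the sup norm. *)
Definition vball d (r : R) : set (borel_rV R d) :=
  [set x | dotp (x : 'rV[R]_d) x < r ^+ 2].

Arguments vball : clear implicits.

Lemma dotpC d (x y : 'rV[R]_d) : dotp x y = dotp y x.
Proof. by apply: eq_bigr => i _; rewrite mulrC. Qed.

Lemma dotpDl d (x y z : 'rV[R]_d) : dotp (x + y) z = dotp x z + dotp y z.
Proof. by rewrite -big_split; apply: eq_bigr => i _; rewrite mxE mulrDl. Qed.

Lemma dotpZl d k (x z : 'rV[R]_d) : dotp (k *: x) z = k * dotp x z.
Proof. by rewrite mulr_sumr; apply: eq_bigr => i _; rewrite mxE mulrA. Qed.

Lemma dotpDr d (x y z : 'rV[R]_d) : dotp z (x + y) = dotp z x + dotp z y.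
Proof. by rewrite !(dotpC z) dotpDl. Qed.

Lemma dotpZr d k (x z : 'rV[R]_d) : dotp z (k *: x) = k * dotp z x.
Proof. by rewrite !(dotpC z) dotpZl. Qed.

Lemma dotpNl d (x z : 'rV[R]_d) : dotp (- x) z = - dotp x z.
Proof. by rewrite -scaleN1r dotpZl mulN1r. Qed.

Lemma dotpNr d (x z : 'rV[R]_d) : dotp z (- x) = - dotp z x.
Proof. by rewrite !(dotpC z) dotpNl. Qed.

Lemma dotp_ge0 d (x : 'rV[R]_d) : 0 <= dotp x x.
Proof. by apply: sumr_ge0 => i _; rewrite -expr2 sqr_ge0. Qed.

Lemma dotp_eq0 d (x : 'rV[R]_d) : (dotp x x == 0) = (x == 0).
Proof.
apply/eqP/eqP => [|->]; last by apply: big1 => i _; rewrite mxE mul0r.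
move=> /psumr_eq0P h; apply/rowP => i; rewrite mxE.
apply/eqP; rewrite -sqrf_eq0 expr2 h// => j _.
by rewrite -expr2 sqr_ge0.
Qed.

Lemma sqr_coord_le d (x : 'rV[R]_d) i : (x 0 i) ^+ 2 <= dotp x x.
Proof.
rewrite /dotp (bigD1 i)//= -expr2 lerDl sumr_ge0// => j _.
by rewrite -expr2 sqr_ge0.
Qed.

Lemma dotp_vcons d (y : 'rV[R]_d) (r : R) :
  dotp (vcons (y, r) : 'rV[R]_d.+1) (vcons (y, r)) = dotp y y + r ^+ 2.
Proof.
rewrite /dotp big_ord_recl vcons0/= addrC expr2; congr (_ + _).
by apply: eq_bigr => i _; rewrite vconsS.
Qed.

Lemma measurable_dotp d disp (T : measurableType disp) (f g : T -> borel_rV R d) :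
  measurable_fun setT f -> measurable_fun setT g ->
  measurable_fun setT (fun t => dotp (f t : 'rV[R]_d) (g t)).
Proof.
move=> mf mg; apply: measurable_sum => i.
by apply: measurable_funM; exact: (measurableT_comp (measurable_coord i)).
Qed.

Lemma measurable_scale d disp (T : measurableType disp) (f : T -> borel_rV R d)
    (k : T -> R) : measurable_fun setT f -> measurable_fun setT k ->
  measurable_fun setT (fun t => k t *: (f t : 'rV[R]_d) : borel_rV R d).
Proof.
move=> mf mk; apply: measurable_fun_rV => i; under eq_fun do rewrite mxE.
by apply: measurable_funM => //; exact: (measurableT_comp (measurable_coord i)).
Qed.

Lemma measurable_vball d r : measurable (vball d r).
Proof.
rewrite /vball -[X in measurable X]setTI.
have md : measurable_fun setT (fun x : borel_rV R d => dotp (x : 'rV[R]_d) x).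
  exact: measurable_dotp.
rewrite [X in _ `&` X](_ : _ = (fun x : borel_rV R d => dotp (x : 'rV[R]_d) x) @^-1`
  `]-oo, r ^+ 2[%classic); first exact: md.
by apply/seteqP; split => x /=; rewrite in_itv.
Qed.

Lemma vball_sub_box d (r : R) : 0 < r ->
  vball d r `<=` box (Some (const_mx (- r), const_mx r)).
Proof.
move=> r0 x xr i; rewrite !mxE.
have : `|(x : 'rV[R]_d) 0 i| ^+ 2 < r ^+ 2.
  by rewrite real_normK ?num_real// (le_lt_trans (sqr_coord_le _ _)).
rewrite ltr_sqr ?nnegrE//; last exact: ltW.
by rewrite ltr_norml => /andP[-> /ltW ->].
Qed.

Lemma vball_ltoo d (r : R) : (mu_rV R d (vball d r) < +oo)%E.
Proof.
have r1 : 0 < `|r| + 1 by rewrite ltr_wpDl.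
apply: (@le_lt_trans _ _ (mu_rV R d (box (Some (const_mx (- (`|r| + 1)) : 'rV[R]_d,
    const_mx (`|r| + 1) : 'rV[R]_d))))); last by rewrite mu_box ltry.
apply: le_measure; rewrite ?inE.
- exact: measurable_vball.
- exact: measurable_box.
apply: subset_trans (vball_sub_box r1) => x /= /lt_trans; apply.
by rewrite -[r ^+ 2]real_normK ?num_real// ltr_sqr ?nnegrE ?ltrDl// ltW.
Qed.

Lemma mu_cube_gt0 d (r : R) : 0 < r ->
  mu_rV R d (box (Some (0 : 'rV[R]_d, const_mx r : 'rV[R]_d))) = (r ^+ d)%:E.
Proof.
move=> r0; rewrite mu_box /= ; congr EFin.
rewrite -[d in RHS]card_ord -prodr_const; apply: eq_bigr => i _.
by rewrite !mxE subr0 max_r// ltW.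
Qed.

Lemma vball_gt0 d (r : R) : 0 < r -> (0 < mu_rV R d (vball d r))%E.
Proof.
(* Points of the cube []0, 1/n]^d] have squared norm at most [d/n^2 <= d/n < r^2]. *)
move=> r0; have [n rn] : exists n : nat, (d%:R < n%:R * r ^+ 2) /\ (0 < n)%N.
  exists (Num.bound (d%:R / r ^+ 2)).+1; split => //.
  rewrite -ltr_pdivrMr ?exprn_gt0//.
  by rewrite (@lt_trans _ _ (Num.bound (d%:R / r ^+ 2))%:R) ?ltr_nat// archi_boundP//
    divr_ge0// exprn_ge0// ltW.
have n0 : (0 < n%:R^-1 :> R) by rewrite invr_gt0 ltr0n; case: rn.
have n1 : (n%:R^-1 <= 1 :> R).
  by case: rn => _ np; rewrite invf_le1 ?ler1n// ltr0n.
apply: (@lt_le_trans _ _ ((n%:R^-1 ^+ d)%:E)); first by rewrite lte_fin exprn_gt0.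
rewrite -mu_cube_gt0//.
apply: le_measure; rewrite ?inE.
- exact: measurable_box.
- exact: measurable_vball.
move=> x xn; rewrite /vball/=; apply: (@le_lt_trans _ _ (\sum_(i < d) n%:R^-1)).
  apply: ler_sum => i _; have := xn i; rewrite !mxE => /andP[h1 h2].
  rewrite (@le_trans _ _ (n%:R^-1 * n%:R^-1))//; first by rewrite ler_pM// ltW.
  by rewrite ler_piMl// ltW.
rewrite sumr_const card_ord -[_ *+ d]mulr_natl ltr_pdivrMr ?ltr0n; last by case: rn.
by rewrite mulrC; case: rn.
Qed.

Lemma mu_opp d (X : set (borel_rV R d)) : measurable X ->
  mu_rV R d [set x | X (- (x : 'rV[R]_d))] = mu_rV R d X.
Proof.
move=> mX; have Y0 := vball_gt0 d (@ltr01 R); have Yoo := vball_ltoo d 1.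
rewrite -(invariant_opp mu_invariant mX (@measurable_vball d 1)) ?Y0 ?Yoo//.
by congr (mu_rV R d _); apply/seteqP; split => x /=; rewrite /subV sub0r.
Qed.

(** The measure of the preimage under [Li] is proportional to [mu_rV]. The factor is read off from a
    convenient [Y]: the unit cube for dilations, the unit ball for reflections. *)
Lemma mu_linear d (L Li : borel_rV R d -> borel_rV R d) (X Y : set (borel_rV R d)) :
  measurable_fun setT Li -> measurable X -> measurable Y ->
  (forall x y, Li (addV (L y) x) = addV (Li x) y) ->
  (mu_rV R d [set x | X (Li x)] * mu_rV R d Y =
   mu_rV R d [set x | Y (Li x)] * mu_rV R d X)%E.
Proof.
move=> mLi mX mY h; rewrite (invariant_unique mu_invariant mLi mX mY h).
congr (_ * _)%E; rewrite -(mu_opp mX).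
by congr (mu_rV R d _); apply/seteqP; split => x /=; rewrite /subV sub0r.
Qed.

Lemma mu_scale d (X : set (borel_rV R d)) (r : R) : 0 < r -> measurable X ->
  (mu_rV R d [set x | X (r^-1 *: (x : 'rV[R]_d))] = (r ^+ d)%:E * mu_rV R d X)%E.
Proof.
move=> r0 mX.
pose Y : set (borel_rV R d) := box (Some (0 : 'rV[R]_d, const_mx 1 : 'rV[R]_d)).
have Y1 : mu_rV R d Y = 1%E by rewrite mu_cube_gt0// expr1n.
have := @mu_linear d (fun x => r *: (x : 'rV[R]_d)) (fun x => r^-1 *: (x : 'rV[R]_d))
  X Y _ mX (measurable_box _) _.
rewrite Y1 mule1 => ->.
- congr (_ * _)%E; rewrite -mu_cube_gt0//; congr (mu_rV R d _).
  apply/seteqP; split => x /= h i; have := h i; rewrite !mxE.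
    by rewrite pmulr_rgt0 ?invr_gt0// mulrC ler_pdivrMr// mul1r.
  by rewrite pmulr_rgt0 ?invr_gt0// mulrC ler_pdivrMr// mul1r.
- exact: (measurable_scale (k := fun=> r^-1)).
- move=> x y; rewrite /addV scalerDr scalerA mulVf ?gt_eqF// scale1r.
  by rewrite addrC.
Qed.

Lemma mu_vball d (r : R) : 0 < r ->
  (mu_rV R d (vball d r) = (r ^+ d)%:E * mu_rV R d (vball d 1))%E.
Proof.
move=> r0; rewrite -mu_scale//; last exact: measurable_vball.
congr (mu_rV R d _); apply/seteqP; split => x /=;
  rewrite /vball/= dotpZl dotpZr mulrA -expr2 exprVn expr1n mulrC ltr_pdivrMr
    ?exprn_gt0// mul1r//.
Qed.

(** Reflection in the hyperplane orthogonal to [w], and the identity for [w = 0], a case that occurs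
    in [householder_axis] when [v] is already on the axis. *)
Definition householder d (w : 'rV[R]_d) (x : borel_rV R d) : borel_rV R d :=
  (x : 'rV[R]_d) - (2 * dotp w x / dotp w w) *: w.

Lemma measurable_householder d (w : 'rV[R]_d) : measurable_fun setT (householder w).
Proof.
apply: measurable_fun_subV => //.
apply: (measurable_scale (f := fun=> w)) => //.
apply: measurable_funM => //; apply: measurable_funM => //.
exact: (measurable_dotp (f := fun=> w)).
Qed.

Lemma householderD d (w : 'rV[R]_d) x y :
  householder w (addV x y) = addV (householder w x) (householder w y).
Proof.
rewrite /householder /addV dotpDr mulrDr mulrDl scalerDl opprD.
by rewrite addrACA.
Qed.

Lemma householderK d (w : 'rV[R]_d) : involutive (householder w).
Proof.
move=> x; rewrite /householder; set c := 2 * dotp w x / dotp w w.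
have [->|w0] := eqVneq w 0; first by rewrite !scaler0 !subr0.
have w0' : dotp w w != 0 by rewrite dotp_eq0.
rewrite -addrA -opprD -scalerDl dotpDr dotpNr dotpZr.
suff -> : c + 2 * (dotp w x - c * dotp w w) / dotp w w = 0 by rewrite scale0r subr0.
by rewrite /c; field.
Qed.

Lemma dotp_householder d (w x : 'rV[R]_d) :
  dotp (householder w x : 'rV[R]_d) (householder w x) = dotp x x.
Proof.
have [->|w0] := eqVneq w 0; first by rewrite /householder !scaler0 !subr0.
have w0' : dotp w w != 0 by rewrite dotp_eq0.
rewrite /householder !(dotpDl, dotpDr, dotpNl, dotpNr, dotpZl, dotpZr).
by rewrite (dotpC x w); field.
Qed.

(** Two vectors [v] and [e] of equal norm are exchanged by the reflection along [v - e]. This brings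
    any direction onto the axis of [steiner]. *)
Lemma householder_axis d (v : 'rV[R]_d.+1) : exists w : 'rV[R]_d.+1,
  householder w v = vcons (0 : 'rV[R]_d, Num.sqrt (dotp v v)).
Proof.
pose e : 'rV[R]_d.+1 := vcons (0 : 'rV[R]_d, Num.sqrt (dotp v v)).
exists (v - e).
have ee : dotp e e = dotp v v.
  rewrite /e dotp_vcons sqr_sqrtr ?dotp_ge0// [X in X + _](_ : _ = 0) ?add0r//.
  by apply/eqP; rewrite dotp_eq0.
have [ve|ve] := eqVneq (v - e) 0.
  by rewrite /householder ve !scaler0 subr0; apply/eqP; rewrite -subr_eq0 ve.
have w0' : dotp (v - e) (v - e) != 0 by rewrite dotp_eq0.
rewrite /householder.
have -> : 2 * dotp (v - e) v / dotp (v - e) (v - e) = 1.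
  suff -> : 2 * dotp (v - e) v = dotp (v - e) (v - e) by rewrite divff.
  rewrite !(dotpDl, dotpDr, dotpNl, dotpNr) ee (dotpC e v); ring.
by rewrite scale1r opprB addrC subrK.
Qed.

Lemma vball_householder d (w : 'rV[R]_d) r :
  [set x | vball d r (householder w x)] = vball d r.
Proof.
by apply/seteqP; split => x /=; rewrite /vball/= dotp_householder.
Qed.

(** The unit ball is invariant, so the factor in [mu_linear] is 1. *)
Lemma mu_householder d (w : 'rV[R]_d) (X : set (borel_rV R d)) : measurable X ->
  mu_rV R d [set x | X (householder w x)] = mu_rV R d X.
Proof.
move=> mX.
have Y0 := vball_gt0 d (@ltr01 R); have Yoo := vball_ltoo d 1.
have fY : mu_rV R d (vball d 1) \is a fin_num by rewrite ge0_fin_numE.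
have hQ x y : householder w (addV (householder w y) x) = addV (householder w x) y.
  by rewrite householderD householderK /addV addrC.
have := @mu_linear d (householder w) (householder w) X (vball d 1)
   (measurable_householder w) mX (@measurable_vball d 1) hQ.
rewrite vball_householder [LHS]muleC => h.
apply/eqP; rewrite eq_le; apply/andP; split; rewrite -(lee_pmul2l fY Y0);
  by rewrite h.
Qed.

End euclidean.
Arguments vball {R} d r.

(** * Symmetrization relative to a ball *)

Section symmetrization.
Context {R : realType} {d : nat}.
Local Notation leb := (leb R).
Local Notation RT := (measurableTypeR R).
Local Notation V := (borel_rV R d.+1).
Local Notation mu := (mu_rV R d.+1).
Local Notation Q := householder.
Implicit Types (A B C S X Y P : set V) (w : 'rV[R]_d.+1).

Definition reflected w A : set V := [set x | A (Q w x)].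

Lemma measurable_reflected w A : measurable A -> measurable (reflected w A).
Proof. by apply: measurable_preimage; exact: measurable_householder. Qed.

Lemma mu_reflected w A : measurable A -> mu (reflected w A) = mu A.
Proof. exact: mu_householder. Qed.

Lemma integral_householder w (h : V -> \bar R) : measurable_fun setT h ->
  (forall x, 0 <= h x)%E -> (\int[mu]_x h (Q w x) = \int[mu]_x h x)%E.
Proof.
move=> mh h0.
transitivity (\int[pushforward mu (Q w)]_x h x)%E.
  by rewrite [RHS](ge0_integral_pushforward (measurable_householder w)).
apply: eq_measure_integral => [|mQ X mX _]; first exact: measurable_householder.
exact: (mu_householder w mX).
Qed.

Lemma corrV_reflected w A B S : measurable A -> measurable B -> measurable S ->
  corrV (reflected w A) (reflected w B) (reflected w S) = corrV A B S.
Proof.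
move=> mA mB mS; rewrite /corrV /corr !prodmE1.
have mW := measurable_corr mu_invariant mA mB mS.
rewrite -[RHS](integral_householder w); last 2 first.
- exact: (measurable_msec1 mu mW).
- by move=> x; exact: measure_ge0.
apply: eq_integral => x _; rewrite -[RHS](mu_householder w); last first.
  exact: (measurable_sec1 _ mW).
by congr (mu _); apply/seteqP; split => y /=; rewrite /reflected/= householderD.
Qed.

Lemma sec_vball (r : R) (y : borel_rV R d) : exists2 e : R, 0 <= e &
  sec (vball d.+1 r) y = centered e%:E.
Proof.
(* [Num.sqrt] vanishes at negative arguments, which yields the empty interval when the fibre misses
   the ball. *)
exists (2 * Num.sqrt (r ^+ 2 - dotp (y : 'rV[R]_d) y)); first by rewrite mulr_ge0.
apply/seteqP; split => s; rewrite /sec /vball/= dotp_vcons /centered/= lte_fin.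
  rewrite addrC -ltrBrDr => h; rewrite -[`|_| *+ 2]mulr_natl ltr_pM2l// -[ltLHS]sqrtr_sqr.
  by rewrite ltr_sqrt// (le_lt_trans _ h)// sqr_ge0.
rewrite -[`|_| *+ 2]mulr_natl ltr_pM2l// => h.
have s0 : 0 < Num.sqrt (r ^+ 2 - dotp (y : 'rV[R]_d) y).
  by rewrite (le_lt_trans _ h).
rewrite addrC -ltrBrDr -(real_normK (num_real s)).
by rewrite -[ltRHS]sqr_sqrtr ?ltr_sqr ?nnegrE// ltW// -sqrtr_gt0.
Qed.

Lemma sec_vball_centered (r : R) y :
  sec (vball d.+1 r) y = centered (leb (sec (vball d.+1 r) y)).
Proof. by have [e e0 ->] := sec_vball r y; rewrite leb_centered. Qed.

Lemma leb_sec_vball (r : R) y : (leb (sec (vball d.+1 r) y) < +oo)%E.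
Proof. by have [e e0 ->] := sec_vball r y; rewrite leb_centered// ltry. Qed.

Lemma le_leb_sec A B y : measurable A -> measurable B -> A `<=` B ->
  (leb (sec A y) <= leb (sec B y))%E.
Proof.
move=> mA mB AB; apply: le_measure; rewrite ?inE; [exact: measurable_sec..|].
by move=> r; exact: AB.
Qed.

Lemma steiner_sub_vball A (r : R) : measurable A -> A `<=` vball d.+1 r ->
  steiner A `<=` vball d.+1 r.
Proof.
move=> mA Ar x Ax.
have : sec (vball d.+1 r) (vtail x) (vhead x).
  rewrite sec_vball_centered; apply: le_centered Ax.
  by apply: le_leb_sec => //; exact: measurable_vball.
by rewrite /sec /=; have /= -> := @vheadtailK R d x.
Qed.

Lemma reflected_sub_vball w A (r : R) :
  A `<=` vball d.+1 r -> reflected w A `<=` vball d.+1 r.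
Proof. by move=> Ar x /Ar; rewrite /vball/= dotp_householder. Qed.

(** On each fibre the new intersection with the ball is a centred interval of length
    [min(|C_y|, |ball_y|)]. Both lengths dominate [|C_y & ball_y| + |P_y|]: [C_y] contains [P_y]
    besides the intersection, and [ball_y] contains the shift of [P_y] by [c]. *)
Lemma steiner_gain C P (r c : R) : measurable C -> measurable P ->
  P `<=` C `\` vball d.+1 r ->
  (forall x, P x -> (vball d.+1 r `\` C) (addV x (vcons ((0 : 'rV[R]_d), c)))) ->
  (mu (C `&` vball d.+1 r) + mu P <= mu (steiner C `&` vball d.+1 r))%E.
Proof.
move=> mC mP PC PcC; have mb := @measurable_vball R d.+1 r.
have mCb : measurable (C `&` vball d.+1 r) by exact: measurableI.
have mSb : measurable (steiner C `&` vball d.+1 r).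
  by apply: measurableI => //; exact: measurable_steiner.
rewrite !mu_sec -ge0_integralD//; [|exact: measurable_leb_sec..].
apply: ge0_le_integral => //.
- by move=> y _; rewrite adde_ge0.
- by apply: emeasurable_funD; exact: measurable_leb_sec.
- exact: measurable_leb_sec.
move=> y _.
have mCy := measurable_sec y mC; have mby := measurable_sec y mb.
have mPy := measurable_sec y mP.
have -> : sec (steiner C `&` vball d.+1 r) y =
    centered (Order.min (leb (sec C y)) (leb (sec (vball d.+1 r) y))).
  transitivity (centered (leb (sec C y)) `&` centered (leb (sec (vball d.+1 r) y))).
    by rewrite -sec_vball_centered -sec_steiner.
  apply/seteqP; split => s; rewrite /centered/= lt_min; first by move=> [-> ->].
  by move=> /andP[].
rewrite leb_centered ?le_min ?measure_ge0//; apply/andP; split.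
  rewrite -measureU//; last 2 first.
  - exact: measurable_sec.
  - by apply/seteqP; split => // s [[_ bs] /PC[_]].
  apply: le_measure; rewrite ?inE//.
  by apply: measurableU => //; exact: measurable_sec.
  by move=> s [[]//|/PC[]].
pose P' : set RT := [set s | sec P y (add1 (- c) s)].
have mP' : measurable P'.
  apply: (measurable_preimage (f := add1 (- c))) => //.
  exact: (measurable_add leb_invariant).
rewrite -(leb_shift (- c) mPy) -/P' -measureU//; last 2 first.
- exact: measurable_sec.
- apply/seteqP; split => // s [[Cs _]].
  by move/PcC; rewrite vconsD => -[_]; apply;
    rewrite /addV addr0 /add1 addrC addNKr.
apply: le_measure; rewrite ?inE//.
  by apply: measurableU => //; exact: measurable_sec.
move=> s [[]//|/PcC[]]; rewrite vconsD /addV addr0 /add1.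
by rewrite addrAC addNr add0r.
Qed.

End symmetrization.

(** * Rearrangement to balls *)

Section integral_shift.
Context disp (T : measurableType disp) (R : realType).
Variable m : {sigma_finite_measure set T -> \bar R}.
Variables (zero : T) (add sub : T -> T -> T).
Hypothesis ti : translation_invariant m zero add sub.

Lemma measurable_shifted (X Y : set T) : measurable X -> measurable Y ->
  measurable [set p : T * T | X p.1 /\ Y (add p.1 p.2)].
Proof.
move=> mX mY; apply: measurableI.
  exact: (measurable_preimage (f := @fst T T)).
exact: (measurable_preimage (ti_add ti)).
Qed.

Lemma measurable_shift_inter (X Y : set T) : measurable X -> measurable Y ->
  measurable_fun setT (fun v => m [set x | X x /\ Y (add x v)]).
Proof.
by move=> mX mY; exact: (measurable_msec2 m (measurable_shifted mX mY)).
Qed.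

Lemma integral_shift (X Y : set T) : measurable X -> measurable Y ->
  (\int[m]_v m [set x | X x /\ Y (add x v)] = m X * m Y)%E.
Proof.
move=> mX mY; have mD := measurable_shifted mX mY.
transitivity (prodm m m [set p : T * T | X p.1 /\ Y (add p.1 p.2)]).
  by rewrite (prodmE2 m m mD).
rewrite prodmE1 muleC -integral_cst// [RHS]integral_mkcond.
apply: eq_integral => x _; rewrite patchE; case: ifPn => [|].
  rewrite inE /= => Xx; rewrite -[RHS](ti_m ti x)//.
  by congr (m _); apply/seteqP; split => [y []|y].
rewrite notin_setE => Xx; rewrite -[RHS](measure0 m); congr (m _).
by apply/seteqP; split => // y [].
Qed.

End integral_shift.

Section convergence.
Context {R : realType} {d : nat}.
Local Notation V := (borel_rV R d.+1).
Local Notation mu := (mu_rV R d.+1).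
Local Notation ball := (vball d.+1).
Implicit Types (A B C S X Y P : set V) (w : 'rV[R]_d.+1).

Lemma fine_mu X (D : R) : measurable X -> X `<=` ball D ->
  mu X = (fine (mu X))%:E.
Proof.
move=> mX XD; rewrite fineK// ge0_fin_numE//.
apply: le_lt_trans (vball_ltoo d.+1 D).
by apply: le_measure; rewrite ?inE//; exact: measurable_vball.
Qed.

(** Parallelogram identity: [|y|^2 + |2x + y|^2 = 2|x|^2 + 2|x + y|^2]. *)
Lemma vball_subV (D : R) (x y : V) : 0 < D -> ball D x -> ball D (addV x y) ->
  ball (2 * D) y.
Proof.
move=> D0; rewrite /vball/= /addV => xD xyD.
have h := dotp_ge0 ((x : 'rV[R]_d.+1) + (x + y)).
rewrite !(dotpDl, dotpDr) in h xyD *; rewrite !(dotpC (y : 'rV[R]_d.+1) x) in h xyD *.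
have -> : (2 * D) ^+ 2 = D ^+ 2 + D ^+ 2 + D ^+ 2 + D ^+ 2 by ring.
lra.
Qed.

(** Averaging over [v]: by [integral_shift] the total is [|X||Y|], and it is carried by
    [ball (2 * D)]. If every [v] failed, the total would be at most half of that; the 2 in the
    denominator provides this slack. *)
Lemma exists_shift X Y (D : R) : 0 < D -> measurable X -> measurable Y ->
  X `<=` ball D -> Y `<=` ball D ->
  exists v : V, ((fine (mu X) * fine (mu Y) / (2 * fine (mu (ball (2 * D)))))%:E <=
    mu [set x | X x /\ Y (addV x v)])%E.
Proof.
move=> D0 mX mY XD YD; apply: contrapT => /forallNP h.
have mb := @measurable_vball R d.+1 (2 * D).
have D20 : 0 < 2 * D by rewrite mulr_gt0.
have VE : mu (ball (2 * D)) = (fine (mu (ball (2 * D))))%:E.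
  by exact: (fine_mu (D := 2 * D)).
have V0 : 0 < fine (mu (ball (2 * D))) by rewrite -lte_fin -VE vball_gt0.
move: VE V0; set vol := fine (mu (ball (2 * D))) => VE V0.
move: h; rewrite -/vol.
have XE := fine_mu mX XD; have YE := fine_mu mY YD.
set x := fine (mu X) in XE *; set y := fine (mu Y) in YE *; move=> h.
have := integral_shift mu_invariant mX mY; rewrite XE YE -EFinM => H.
have le : (\int[mu]_v mu [set x | X x /\ Y (addV x v)] <=
    \int[mu]_v ((cst (x * y / (2 * vol))%:E) \_ (ball (2 * D))) v)%E.
  apply: ge0_le_integral => //.
  - exact: (measurable_shift_inter mu_invariant mX mY).
  - by apply/(measurable_restrictT _ _).1 => //; exact: measurable_cst.
  move=> v _; rewrite patchE; case: ifPn => [_|].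
    by apply: ltW; rewrite ltNge; apply/negP; exact: h.
  rewrite notin_setE => bv; rewrite (_ : [set _ | _] = set0) ?measure0//.
  apply/seteqP; split => // z [/XD Xz /YD Yz]; apply: bv.
  exact: vball_subV Xz Yz.
have Ic : (\int[mu]_v ((cst (x * y / (2 * vol))%:E) \_ (ball (2 * D))) v =
    (x * y / (2 * vol))%:E * mu (ball (2 * D)))%E.
  by rewrite -integral_mkcond; exact: integral_cst.
move: le; rewrite H Ic VE -EFinM lee_fin.
have [v0|v0] := leP (x * y) 0.
  case: (h 0); apply: le_trans (measure_ge0 _ _).
  by rewrite lee_fin pmulr_lle0// invr_gt0 mulr_gt0.
have -> : x * y / (2 * vol) * vol = x * y / 2 by field; rewrite gt_eqF.
lra.
Qed.

Definition defect (r : R) A := fine (mu (A `\` ball r)).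

Lemma defectE (r D : R) A : measurable A -> A `<=` ball D ->
  defect r A = fine (mu A) - fine (mu (A `&` ball r)).
Proof.
move=> mA AD; have mb := @measurable_vball R d.+1 r.
have AE := fine_mu mA AD.
have IE : mu (A `&` ball r) = (fine (mu (A `&` ball r)))%:E.
  by apply: (fine_mu (D := D)); [exact: measurableI|move=> x [/AD]].
rewrite /defect.
have -> : mu (A `\` ball r) = (mu A - mu (A `&` ball r))%E.
  by apply: measureD => //=; rewrite AE ltry.
by rewrite AE IE.
Qed.

(** The result is not reflected back: balls, measures and [corrV] are invariant under
    reflections. *)
Definition steiner_along w A := steiner (reflected w A).

Lemma sym_props w A (D : R) : measurable A -> A `<=` ball D ->
  [/\ measurable (steiner_along w A), steiner_along w A `<=` ball D &
     mu (steiner_along w A) = mu A].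
Proof.
move=> mA AD; have mr := measurable_reflected w mA; split.
- exact: measurable_steiner.
- by apply: steiner_sub_vball => //; exact: reflected_sub_vball.
- by rewrite /steiner_along (mu_steiner mr) (mu_reflected w mA).
Qed.

Lemma sym_gain w A P (r D c : R) : measurable A -> A `<=` ball D ->
  measurable P -> P `<=` reflected w A `\` ball r ->
  (forall x, P x -> (ball r `\` reflected w A) (addV x (vcons ((0 : 'rV[R]_d), c)))) ->
  defect r (steiner_along w A) <= defect r A - fine (mu P).
Proof.
move=> mA AD mP PA PcA; have mr := measurable_reflected w mA.
have rD : reflected w A `<=` ball D by exact: reflected_sub_vball.
have mb := @measurable_vball R d.+1 r.
have [ms sD sA] := sym_props w mA AD.
have := steiner_gain mr mP PA PcA.
rewrite (fine_mu (D := D)); [|exact: measurableI|by move=> x [/rD]].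
rewrite (fine_mu (X := P) (D := D)) //; last by move=> x /PA[/rD].
rewrite [leRHS](fine_mu (D := D)); [|exact: measurableI|by move=> x [/sD]].
rewrite -EFinD lee_fin (defectE r ms sD) (defectE r mA AD) sA -/(steiner_along w A).
have -> : mu (reflected w A `&` ball r) = mu (A `&` ball r).
  rewrite -(mu_reflected w (A := A `&` ball r)); last exact: measurableI.
  congr (mu _); apply/seteqP; split => x [Ax] bx; split => //; move: bx;
    by rewrite /vball/= dotp_householder.
lra.
Qed.

Lemma sym_nonincreasing w A (r D : R) : measurable A -> A `<=` ball D ->
  defect r (steiner_along w A) <= defect r A.
Proof.
move=> mA AD.
have := @sym_gain w A set0 r D 0 mA AD measurable0 (@sub0set _ _) (fun x h => False_ind _ h).
by rewrite measure0 subr0.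
Qed.

Lemma sym_improve A (r D : R) : 0 < D -> measurable A -> A `<=` ball D ->
  ball r `<=` ball D -> (mu A <= mu (ball r))%E ->
  exists w, defect r (steiner_along w A) <=
    defect r A - defect r A ^+ 2 / (2 * fine (mu (ball (2 * D)))).
Proof.
move=> D0 mA AD rD Ar; have mb := @measurable_vball R d.+1 r.
pose X := A `\` ball r; pose Y := ball r `\` A.
have mX : measurable X by exact: measurableD.
have mY : measurable Y by exact: measurableD.
have XD : X `<=` ball D by move=> x [/AD].
have YD : Y `<=` ball D by move=> x [/rD].
(* Because [A] has at most the measure of the ball, what it lacks inside is at least what it has
   outside. *)
have XY : defect r A <= fine (mu Y).
  have rE := fine_mu mb rD.
  rewrite (defectE r mA AD) /Y.
  have -> : mu (ball r `\` A) = (mu (ball r) - mu (ball r `&` A))%E.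
    by apply: measureD => //=; exact: vball_ltoo.
  have IE : mu (A `&` ball r) = (fine (mu (A `&` ball r)))%:E.
    by apply: (fine_mu (D := D)); [exact: measurableI|move=> x [/AD]].
  move: Ar; rewrite (setIC (ball r) A) (fine_mu mA AD) rE IE -EFinB/= lee_fin.
  by rewrite lerD2r.
have [v] := exists_shift D0 mX mY XD YD.
rewrite -[fine (mu X)]/(defect r A).
have [w wv] := householder_axis (v : 'rV[R]_d.+1).
set c := Num.sqrt _ in wv.
pose P0 := [set x | X x /\ Y (addV x v)].
have mP0 : measurable P0.
  apply: measurableI => //.
  apply: (measurable_preimage (f := fun x => addV x v)) => //.
  exact: measurable_fun_addV.
(* In reflected coordinates the translation by [v] is a translation by [c] along the axis, the form
   expected by [sym_gain]. *)
have vw : householder w (vcons (0 : 'rV[R]_d, c)) = v by rewrite -wv householderK.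
pose P := reflected w P0.
have mP : measurable P by exact: measurable_reflected.
have PA : P `<=` reflected w A `\` ball r.
  by move=> x [[Ax bx] _]; split => // bx'; apply: bx; move: bx';
    rewrite /vball/= dotp_householder.
have PcA x : P x -> (ball r `\` reflected w A) (addV x (vcons ((0 : 'rV[R]_d), c))).
  move=> [_]; rewrite -vw -householderD => -[br Ax]; split => //.
  by move: br; rewrite /vball/= dotp_householder.
have := sym_gain mA AD mP PA PcA => gain h; exists w.
apply: (le_trans gain); rewrite lerB// -lee_fin.
have PD : P `<=` ball D by move=> x /PA[rx _]; exact: (reflected_sub_vball AD rx).
rewrite -(fine_mu mP PD) (mu_reflected w mP0); apply: le_trans h.
rewrite lee_fin expr2 ler_wpM2r ?invr_ge0 ?mulr_ge0 ?fine_ge0//.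
by rewrite ler_wpM2l// /defect fine_ge0.
Qed.

(** [S'] is known only through its measure, the one feature of it that [vball_corr_bound] looks
    at. *)
Definition better A B A' B' := forall S, measurable S ->
  exists S', [/\ measurable S', mu S' = mu S & (corrV A B S <= corrV A' B' S')%E].

Lemma better_refl A B : better A B A B.
Proof. by move=> S mS; exists S. Qed.

Lemma better_sym w A B A' B' (D : R) : measurable A' -> measurable B' ->
  A' `<=` ball D -> B' `<=` ball D -> better A B A' B' ->
  better A B (steiner_along w A') (steiner_along w B').
Proof.
move=> mA mB AD BD AB S mS; have [S1 [mS1 S1S h1]] := AB S mS.
have mrA := measurable_reflected w mA; have mrB := measurable_reflected w mB.
have mrS := measurable_reflected w mS1.
exists (steiner_along w S1); split.
- exact: measurable_steiner.
- by rewrite /steiner_along (mu_steiner mrS) (mu_reflected w mS1).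
rewrite (le_trans h1)// -(corrV_reflected w mA mB mS1).
apply: corrV_steiner => // y;
 by apply: le_lt_trans (leb_sec_vball D y); apply: le_leb_sec => //;
  [exact: measurable_vball|exact: reflected_sub_vball].
Qed.

(** Let [q] be the infimum of the sum of the two defects over all admissible pairs [K]. If [q > 0],
    a near-minimizer has a defect of at least [q/2]; symmetrizing it lowers that defect by a fixed
    amount and does not raise the other, which contradicts the infimum. The common ball of radius
    [D] keeps the amount uniform. *)
Lemma symmetrize A B (a b D e : R) : 0 < D -> measurable A -> measurable B ->
  A `<=` ball D -> B `<=` ball D -> ball a `<=` ball D -> ball b `<=` ball D ->
  (mu A <= mu (ball a))%E -> (mu B <= mu (ball b))%E -> 0 < e ->
  exists A' B', [/\ measurable A' /\ measurable B', mu A' = mu A /\ mu B' = mu B,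
    (mu (A' `\` ball a) <= e%:E)%E, (mu (B' `\` ball b) <= e%:E)%E &
    better A B A' B'].
Proof.
move=> D0 mA mB AD BD aD bD Aa Bb e0.
pose K (p : set V * set V) := [/\ measurable p.1 /\ measurable p.2,
  p.1 `<=` ball D /\ p.2 `<=` ball D, mu p.1 = mu A /\ mu p.2 = mu B &
  better A B p.1 p.2].
pose E := [set defect a p.1 + defect b p.2 | p in K].
have Edef p : K p -> E (defect a p.1 + defect b p.2) by move=> Kp; exists p.
have d0 r C : 0 <= defect r C by rewrite /defect fine_ge0.
have E0 : E !=set0.
  by exists (defect a A + defect b B); exists (A, B) => //; split => //=; exact: better_refl.
have Elb : lbound E 0 by move=> _ [p _ <-]; rewrite addr_ge0.
have hE : has_inf E by split => //; exists 0.
pose q := inf E.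
have q0 : 0 <= q by exact: lb_le_inf.
have Ksym w p : K p -> K (steiner_along w p.1, steiner_along w p.2).
  move=> [[m1 m2] [s1 s2] [a1 a2] bt].
  have [m1' s1' e1] := sym_props w m1 s1.
  have [m2' s2' e2] := sym_props w m2 s2.
  split => /=; [by split|by split|by rewrite e1 e2|].
  have h := better_sym w m1 m2 s1 s2 bt.
  exact: h.
have qE0 : q = 0.
  apply/eqP; rewrite eq_le q0 andbT leNgt; apply/negP => qp.
  pose vol := fine (mu (ball (2 * D))).
  have V0 : 0 < vol.
    rewrite -lte_fin -(fine_mu (@measurable_vball R d.+1 (2 * D)) (@subset_refl _ _)).
    by rewrite vball_gt0// mulr_gt0.
  (* The gain that [sym_improve] guarantees for a defect of at least [q/2]. *)
  pose eta := (q / 2) ^+ 2 / (2 * vol).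
  have eta0 : 0 < eta by rewrite divr_gt0 ?exprn_gt0 ?divr_gt0// mulr_gt0.
  have [_ [p Kp <-]] := inf_adherent eta0 hE; rewrite -/q => pq.
  have [[m1 m2] [s1 s2] [a1 a2] bt] := Kp.
  have qp2 : q <= defect a p.1 + defect b p.2.
    exact: (ge_inf hE.2 (Edef p Kp)).
  have etaE x : q / 2 <= x -> eta <= x ^+ 2 / (2 * vol).
    move=> qx; rewrite ler_pM2r ?invr_gt0 ?mulr_gt0//.
    by rewrite ler_sqr ?nnegrE//; lra.
  have [h|h] := leP (q / 2) (defect a p.1).
    have [w hw] : exists w, defect a (steiner_along w p.1) <=
        defect a p.1 - defect a p.1 ^+ 2 / (2 * vol).
      by apply: sym_improve => //; rewrite a1.
    have := ge_inf hE.2 (Edef _ (Ksym w p Kp)); rewrite /= -/q.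
    have := sym_nonincreasing w b m2 s2; have := etaE _ h; lra.
  have h2 : q / 2 <= defect b p.2 by lra.
  have [w hw] : exists w, defect b (steiner_along w p.2) <=
      defect b p.2 - defect b p.2 ^+ 2 / (2 * vol).
    by apply: sym_improve => //; rewrite a2.
  have := ge_inf hE.2 (Edef _ (Ksym w p Kp)); rewrite /= -/q.
  have := sym_nonincreasing w a m1 s1; have := etaE _ h2; lra.
have [_ [p Kp <-]] := inf_adherent e0 hE; rewrite -/q qE0 add0r => pe.
have [[m1 m2] [s1 s2] [a1 a2] bt] := Kp.
have := d0 a p.1; have := d0 b p.2 => d2 d1.
exists p.1, p.2; split => //.
- rewrite (fine_mu (D := D)); [|
    by apply: measurableD => //; exact: measurable_vball|by move=> x [/s1]].
  by rewrite lee_fin -/(defect a p.1); lra.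
- rewrite (fine_mu (D := D)); [|
    by apply: measurableD => //; exact: measurable_vball|by move=> x [/s2]].
  by rewrite lee_fin -/(defect b p.2); lra.
Qed.

End convergence.

(** * Riesz-Sobolev for sets of finite measure, up to an error *)

Section riesz.
Context {R : realType} {d : nat}.
Local Notation V := (borel_rV R d.+1).
Local Notation mu := (mu_rV R d.+1).
Local Notation ball := (vball d.+1).
Implicit Types (A B S : set V).

Lemma corrV_approx A B A' B' S : measurable A -> measurable B ->
  measurable A' -> measurable B' -> measurable S ->
  (corrV A B S <= corrV A' B' S + (mu (A `\` A') * mu B + mu A * mu (B `\` B')))%E.
Proof.
move=> mA mB mA' mB' mS.
have mAA' : measurable (A `\` A') by exact: measurableD.
have mBB' : measurable (B `\` B') by exact: measurableD.
rewrite -(prodmX mu mu mAA' mB) -(prodmX mu mu mA mBB').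
have m1 := measurable_corr mu_invariant mA' mB' mS.
have m2 : measurable ((A `\` A') `*` B) by exact: measurableX.
have m3 : measurable (A `*` (B `\` B')) by exact: measurableX.
apply: (@le_trans _ _ (prodm mu mu ([set p | [/\ A' p.1, B' p.2 & S (addV p.1 p.2)]] `|`
  (((A `\` A') `*` B) `|` (A `*` (B `\` B')))))).
  apply: le_measure; rewrite ?inE.
  - exact: (measurable_corr mu_invariant mA mB mS).
  - by apply: measurableU => //; exact: measurableU.
  move=> [x y] /= [Ax By Sxy].
  have [A'x|A'x] := pselect (A' x); last by right; left.
  by have [B'y|B'y] := pselect (B' y); [left|right; right].
apply: (le_trans (measureU2 _ _ _)) => //; first exact: measurableU.
rewrite leeD2l//; exact: measureU2.
Qed.

Lemma corrV_leM A B S : measurable A -> measurable B -> measurable S ->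
  (corrV A B S <= mu A * mu B)%E.
Proof.
move=> mA mB mS; rewrite -(prodmX mu mu mA mB).
apply: le_measure; rewrite ?inE; [exact: (measurable_corr mu_invariant)| |].
  exact: measurableX.
by move=> [x y] /= [].
Qed.

Lemma subset_vball (r s : R) : 0 <= r -> r <= s -> ball r `<=` ball s.
Proof.
move=> r0 rs x; rewrite /vball/= => /lt_le_trans; apply.
by rewrite ler_sqr ?nnegrE// (le_trans r0).
Qed.

Lemma vball_tail A (e : R) : measurable A -> (mu A < +oo)%E -> 0 < e ->
  exists k0 : nat, forall k : nat, (k0 <= k)%N -> (mu (A `\` ball k%:R) <= e%:E)%E.
Proof.
move=> mA Aoo e0.
have mF k : measurable (A `\` ball k%:R).
  by apply: measurableD => //; exact: measurable_vball.
have Ff k : (mu (A `\` ball k%:R) < +oo)%E.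
  by apply: le_lt_trans Aoo; apply: le_measure; rewrite ?inE//; exact: subDsetl.
have : mu \o (fun k : nat => A `\` ball k%:R) @ \oo --> (0 : R)%:E.
  rewrite -[X in _ --> X](measure0 mu).
  rewrite (_ : set0 = \bigcap_(k : nat) (A `\` ball k%:R)); last first.
    apply/esym/seteqP; split => // x h.
    have [_] := h (Num.bound (dotp (x : 'rV[R]_d.+1) x)).+1 I; apply.
    rewrite /vball/=; set n := Num.bound _.
    have xn : dotp (x : 'rV[R]_d.+1) x < n%:R by apply: archi_boundP; exact: dotp_ge0.
    rewrite (lt_le_trans xn)// -natrX ler_nat.
    by rewrite expnS expn1 (leq_trans (leqnSn n))// leq_pmulr.
  apply: nonincreasing_cvg_mu => //.
  - exact: Ff.
  - exact: bigcapT_measurable.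
  move=> m n mn; apply/subsetPset => x [Ax nx]; split => // mx; apply: nx.
  by apply: subset_vball mx => //; rewrite ler_nat.
move=> /fine_cvgP[_ /cvgrPdist_lt /(_ e e0) [k0 _ k0P]].
exists k0 => k kk0; have := k0P k kk0; rewrite /= sub0r normrN ger0_norm ?fine_ge0//.
move=> /ltW; rewrite -lee_fin fineK// ge0_fin_numE//; exact: Ff.
Qed.

(** [A] and [B] are cut to a large ball, then symmetrized until almost nothing of them lies outside
    [ball a] and [ball b]. The set [S'] depends on [e], which is harmless because its measure does
    not. *)
Lemma riesz_ball A B S (a b e : R) : 0 < a -> 0 < b -> 0 < e ->
  measurable A -> measurable B -> measurable S ->
  (mu A <= mu (ball a))%E -> (mu B <= mu (ball b))%E ->
  exists S', [/\ measurable S', mu S' = mu S &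
    (corrV A B S <= corrV (ball a) (ball b) S' + e%:E)%E].
Proof.
move=> a0 b0 e0 mA mB mS Aa Bb.
have Aoo := le_lt_trans Aa (vball_ltoo d.+1 a).
have Boo := le_lt_trans Bb (vball_ltoo d.+1 b).
have AE : mu A = (fine (mu A))%:E by rewrite fineK// ge0_fin_numE.
have BE : mu B = (fine (mu B))%:E by rewrite fineK// ge0_fin_numE.
set x := fine (mu A) in AE; set y := fine (mu B) in BE.
have x0 : 0 <= x by rewrite fine_ge0.
have y0 : 0 <= y by rewrite fine_ge0.
(* [corrV_approx] is applied twice, once for the cut and once for the passage to the balls, at a
   cost of at most [r * (x + y)] each time. *)
have err u : 0 < u -> exists2 r, 0 < r & r * (x + y) <= u.
  move=> u0; exists (u / (x + y + 1)); first by rewrite divr_gt0// ltr_wpDl// addr_ge0.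
  have xy1 : 0 < x + y + 1 by rewrite ltr_wpDl// addr_ge0.
  by rewrite mulrAC ler_pdivrMr// ler_pM2l// lerDl.
have e20 : 0 < e / 2 by rewrite divr_gt0.
have [r r0 re] := err _ e20.
have [kA kAP] := vball_tail mA Aoo r0.
have [kB kBP] := vball_tail mB Boo r0.
pose k := maxn kA kB.
have mb s := @measurable_vball R d.+1 s.
pose A1 := A `&` ball k%:R; pose B1 := B `&` ball k%:R.
have mA1 : measurable A1 by exact: measurableI.
have mB1 : measurable B1 by exact: measurableI.
have A1A : (mu A1 <= mu A)%E by apply: le_measure; rewrite ?inE//; exact: subIsetl.
have B1B : (mu B1 <= mu B)%E by apply: le_measure; rewrite ?inE//; exact: subIsetl.
pose D := k%:R + a + b.
have k0 : 0 <= k%:R :> R by [].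
have D0 : 0 < D by rewrite /D; lra.
have A1D : A1 `<=` ball D.
  by move=> z [_]; apply: subset_vball => //; rewrite /D; lra.
have B1D : B1 `<=` ball D.
  by move=> z [_]; apply: subset_vball => //; rewrite /D; lra.
have aD : ball a `<=` ball D by apply: subset_vball; rewrite /D; lra.
have bD : ball b `<=` ball D by apply: subset_vball; rewrite /D; lra.
have [A' [B' [[mA' mB'] [A'E B'E] hA hB bt]]] :=
  symmetrize D0 mA1 mB1 A1D B1D aD bD (le_trans A1A Aa) (le_trans B1B Bb) r0.
have [S' [mS' S'S h]] := bt S mS; exists S'; split => //.
have le2 (u v u' v' : \bar R) : (0 <= u)%E -> (0 <= v)%E ->
   (0 <= u')%E -> (0 <= v')%E ->
   (u <= r%:E)%E -> (u' <= r%:E)%E -> (v <= y%:E)%E -> (v' <= x%:E)%E ->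
   (u * v + v' * u' <= (e / 2)%:E)%E.
  move=> u0 v0 u'0 v'0 ur u'r vy vx.
  apply: (@le_trans _ _ (r%:E * y%:E + x%:E * r%:E)%E).
    by apply: leeD; apply: lee_pmul.
  by rewrite -!EFinM -EFinD lee_fin; lra.
apply: (le_trans (corrV_approx mA mB mA1 mB1 mS)).
apply: (@le_trans _ _ (corrV A' B' S' + (e / 2)%:E)%E).
  apply: leeD => //; apply: le2 => //; rewrite ?AE ?BE//.
  - by rewrite setDIr setDv set0U kAP// leq_maxl.
  - by rewrite setDIr setDv set0U kBP// leq_maxr.
apply: (le_trans (leeD (corrV_approx mA' mB' (mb a) (mb b) mS') (lexx _))).
rewrite -addeA leeD2l// [e in leRHS]splitr EFinD leeD2r//.
by apply: le2 => //; rewrite ?A'E ?B'E -?AE -?BE.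
Qed.

End riesz.

(** * Truncated convolutions of balls *)

Section lens.
Context {R : realType} {d : nat}.
Local Notation V := (borel_rV R d.+1).
Local Notation mu := (mu_rV R d.+1).
Local Notation ball := (vball d.+1).
Implicit Types (A B S : set V).

(** The convolution of the indicators of [A] and [B] at [z]. *)
Definition overlap A B (z : V) : \bar R := mu [set x | A x /\ B (subV z x)].

Lemma measurable_overlap_slice A B z : measurable A -> measurable B ->
  measurable [set x | A x /\ B (subV z x)].
Proof.
move=> mA mB; apply: measurableI => //.
apply: (measurable_preimage (f := fun x => subV z x)) => //.
exact: measurable_fun_subV.
Qed.

Lemma measurable_overlap A B : measurable A -> measurable B ->
  measurable_fun setT (overlap A B).
Proof.
move=> mA mB.
apply: (measurable_shear mu_invariant (W := [set p | A p.1 /\ B p.2])).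
apply: measurableI; first exact: (measurable_preimage (f := @fst V V)).
exact: (measurable_preimage (f := @snd V V)).
Qed.

Lemma overlap_ge0 A B z : (0 <= overlap A B z)%E.
Proof. exact: measure_ge0. Qed.

(* Volume of a box inscribed in the intersection of two balls of radii at least m
   that overlap to depth dl: its sides are dl/2 along the line of centres and
   sqrt (m dl / (d+1)) in the d orthogonal directions. *)
Definition lens_volume (m dl : R) : R := Num.sqrt (m * dl / d.+1%:R) ^+ d * (dl / 2).

Lemma overlap_vball (al be m dl : R) (z : V) : 0 < dl -> dl <= m ->
  m <= al -> m <= be -> ball (al + be - dl) z ->
  ((lens_volume m dl)%:E <= overlap (ball al) (ball be) z)%E.
Proof.
move=> dl0 dlm mal mbe; rewrite /vball/= => zr.
have m0 : 0 < m by exact: lt_le_trans dlm.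
have r0 : 0 < al + be - dl by lra.
have [w wz] := householder_axis (z : 'rV[R]_d.+1).
set c := Num.sqrt _ in wz.
have c0 : 0 <= c by exact: sqrtr_ge0.
have cr : c < al + be - dl.
  by rewrite -(ltr_pXn2r (n := 2)) ?nnegrE ?(ltW r0)// sqr_sqrtr ?dotp_ge0.
(* The centre of the box, which divides the segment of length [c] between the centres in the ratio
   of [al - dl/2] to [be - dl/2], so that it has depth at least [dl/2] in both balls. *)
pose c1 := c * ((al - dl / 2) / (al + be - dl)).
have c1E : 0 <= c1 <= al - dl / 2.
  apply/andP; split; first by rewrite mulr_ge0// divr_ge0; lra.
  rewrite /c1 mulrA ler_pdivrMr// mulrC ler_wpM2l; lra.
have c2E : 0 <= c - c1 <= be - dl / 2.
  have -> : c - c1 = c * ((be - dl / 2) / (al + be - dl)).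
    by rewrite /c1; field; rewrite gt_eqF.
  apply/andP; split; first by rewrite mulr_ge0// divr_ge0; lra.
  rewrite mulrA ler_pdivrMr// mulrC ler_wpM2l; lra.
pose rho := Num.sqrt (m * dl / d.+1%:R) / 2.
have rho0 : 0 <= rho by rewrite divr_ge0.
pose I := Some (vcons ((const_mx (- rho) : 'rV[R]_d), c1 - dl / 4) : 'rV[R]_d.+1,
  vcons ((const_mx rho : 'rV[R]_d), c1 + dl / 4) : 'rV[R]_d.+1).
have IE : mu (box I) = (lens_volume m dl)%:E.
  rewrite mu_box /= big_ord_recl !vcons0/=; congr EFin; rewrite mulrC.
  congr (_ * _); last by rewrite max_r; lra.
  rewrite -[X in _ ^+ X]card_ord -prodr_const; apply: eq_bigr => i _.
  by rewrite !vconsS/= !mxE max_r; [rewrite /rho; lra|lra].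
have normE (y : 'rV[R]_d) s : (forall i, `|y 0 i| <= rho) ->
    dotp (vcons (y, s) : 'rV[R]_d.+1) (vcons (y, s)) <= m * dl / 4 + s ^+ 2.
  move=> yr; rewrite dotp_vcons lerD2r /dotp.
  apply: (@le_trans _ _ (\sum_(i < d) rho ^+ 2)).
    apply: ler_sum => i _; rewrite -expr2 -[y 0 i ^+ 2]real_normK ?num_real//.
    by rewrite ler_sqr ?nnegrE.
  rewrite sumr_const card_ord /rho exprMn sqr_sqrtr; last first.
    by rewrite divr_ge0// mulr_ge0// ltW.
  rewrite -[_ *+ d]mulr_natl.
  have h : d%:R <= d.+1%:R :> R by rewrite ler_nat.
  have d1 : (d.+1%:R : R) != 0 by rewrite pnatr_eq0.
  have -> : d%:R * (m * dl / d.+1%:R * 2^-1 ^+ 2) = (m * dl / 4) * (d%:R / d.+1%:R).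
    by move: d1; set D1 := d.+1%:R => d1; field.
  rewrite ler_piMr//; first by rewrite divr_ge0// mulr_ge0// ltW.
  by rewrite ler_pdivrMr ?ltr0n// mul1r.
(* Expanding [(r - dl/4)^2] saves [r dl/2 - dl^2/16], which exceeds the transversal [m dl/4] because
   [dl <= m <= r]. *)
have sqE r s : m <= r -> - (r - dl / 4) <= s <= r - dl / 4 ->
    m * dl / 4 + s ^+ 2 < r ^+ 2.
  move=> mr /andP[h1 h2].
  have : s ^+ 2 <= (r - dl / 4) ^+ 2.
    by rewrite -[s ^+ 2]real_normK ?num_real// ler_sqr ?nnegrE// ?ler_norml ?h1//; lra.
  nra.
rewrite -IE /overlap -(mu_householder w (X := [set x | ball al x /\ _])); last first.
  apply: measurable_overlap_slice; exact: measurable_vball.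
apply: le_measure; rewrite ?inE.
- exact: measurable_box.
- apply: (measurable_preimage (measurable_householder w)).
  apply: measurable_overlap_slice; exact: measurable_vball.
move=> x xI; rewrite /= /vball/= dotp_householder.
have yr i : `|(vtail x : 'rV[R]_d) 0 i| <= rho.
  have := xI (lift ord0 i); rewrite !vconsS !mxE => /andP[h1 h2].
  by rewrite ler_norml h2 ltW.
have sr : c1 - dl / 4 < (vhead x : R) <= c1 + dl / 4.
  by have := xI ord0; rewrite !vcons0.
have /= xE := @vheadtailK R d x.
split.
  rewrite -xE; apply: le_lt_trans (normE _ _ yr) _; apply: sqE => //.
  by move: sr c1E; clear; move=> /andP[? ?] /andP[? ?]; lra.
have -> : subV z (householder w x) = householder w (subV (vcons ((0 : 'rV[R]_d), c)) x).
  by rewrite /subV -wz /addV -[X in _ = X]/(householder w (addV _ (- _))) householderD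
    householderK /addV; congr (_ + _); rewrite /householder dotpNr mulrN mulNr scaleNr
    opprD opprK.
rewrite dotp_householder.
have -> : subV (vcons ((0 : 'rV[R]_d), c)) x =
    vcons (- (vtail x : 'rV[R]_d), c - (vhead x : R)).
  rewrite -{1}xE; apply/rowP => i; rewrite /subV !mxE; case: unliftP => //= j _.
  by rewrite !mxE sub0r.
have yr' i : `|(- (vtail x : 'rV[R]_d)) 0 i| <= rho.
  by rewrite mxE normrN.
apply: le_lt_trans (normE _ _ yr') _; apply: sqE => //.
by move: sr c2E; clear; move=> /andP[? ?] /andP[? ?]; lra.
Qed.

End lens.
Arguments lens_volume {R} d m dl.

Section truncated_integral.
Context {R : realType} {d : nat}.
Local Notation V := (borel_rV R d.+1).
Local Notation mu := (mu_rV R d.+1).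
Local Notation ball := (vball d.+1).
Implicit Types (A B S : set V).

Lemma corrV_overlap A B S : measurable A -> measurable B -> measurable S ->
  corrV A B S = (\int[mu]_(z in S) overlap A B z)%E.
Proof. exact: (corrE mu_invariant). Qed.

Lemma corrV_setT A B : measurable A -> measurable B ->
  corrV A B setT = (mu A * mu B)%E.
Proof.
move=> mA mB; rewrite -(prodmX mu mu mA mB); congr (prodm mu mu _).
by apply/seteqP; split => -[x y] /= []; [|split].
Qed.

Lemma corrV_setC A B S : measurable A -> measurable B -> measurable S ->
  (corrV A B S + corrV A B (~` S) = mu A * mu B)%E.
Proof.
move=> mA mB mS; have mSC := measurableC mS.
rewrite -corrV_setT//.
have -> : corrV A B setT = prodm mu mu ([set p | [/\ A p.1, B p.2 & S (addV p.1 p.2)]] `|`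
   [set p | [/\ A p.1, B p.2 & (~` S) (addV p.1 p.2)]]).
  congr (prodm mu mu _); apply/seteqP; split => -[x y] /=.
    move=> [Ax By _]; have [Sxy|Sxy] := pselect (S (addV x y)); first by left.
    by right.
  by case=> -[].
apply/esym; apply: measureU.
- exact: (measurable_corr mu_invariant mA mB mS).
- exact: (measurable_corr mu_invariant mA mB mSC).
- by apply/seteqP; split => // -[x y] /= [[_ _ h] [_ _]].
Qed.

(** The overlap is at least [t] on the smaller ball [U], so the complement of [S] receives at least
    [t (|U| - |S|)] of the total mass [|ball al| |ball be|]. *)
Lemma vball_corr_bound (al be m dl t : R) S : 0 < dl -> dl <= m -> m <= al ->
  m <= be -> 0 <= t <= lens_volume d m dl -> measurable S ->
  (corrV (ball al) (ball be) S + t%:E * mu (ball (al + be - dl)) <=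
   mu (ball al) * mu (ball be) + t%:E * mu S)%E.
Proof.
move=> dl0 dlm mal mbe /andP[t0 tl] mS.
have mb r := @measurable_vball R d.+1 r.
set U := ball (al + be - dl).
have mU : measurable U by exact: mb.
have mUS : measurable (U `\` S) by exact: measurableD.
have h1 : (mu U <= mu (U `\` S) + mu S)%E.
  apply: (@le_trans _ _ (mu ((U `\` S) `|` S))).
    apply: le_measure; rewrite ?inE//; first exact: measurableU.
    by move=> x Ux; have [Sx|Sx] := pselect (S x); [right|left].
  exact: measureU2.
have h2 : (t%:E * mu (U `\` S) <= corrV (ball al) (ball be) (~` S))%E.
  rewrite corrV_overlap//; last exact: measurableC.
  have -> : (t%:E * mu (U `\` S))%E = (\int[mu]_z ((cst t%:E) \_ (U `\` S)) z)%E.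
    by rewrite -integral_mkcond integral_cst.
  rewrite [leRHS]integral_mkcond; apply: ge0_le_integral => //.
  - by move=> z _; rewrite patchE; case: ifP => // _; rewrite lee_fin.
  - by apply/(measurable_restrictT _ _).1 => //; exact: measurable_cst.
  - apply/(measurable_restrictT _ _).1; first exact: measurableC.
    by apply: measurable_funTS; exact: measurable_overlap.
  move=> z _; rewrite !patchE; case: ifPn => [|_].
    rewrite inE => -[Uz Sz]; rewrite mem_set//.
    by apply: le_trans (overlap_vball dl0 dlm mal mbe Uz); rewrite lee_fin.
  by case: ifP => // _; exact: overlap_ge0.
apply: (@le_trans _ _ (corrV (ball al) (ball be) S +
    (t%:E * mu (U `\` S) + t%:E * mu S))%E).
  rewrite leeD2l// -muleDr ?lee_wpmul2l//.
  by apply: ge0_adde_def; rewrite inE.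
by rewrite addeA leeD2r// -(corrV_setC _ _ mS)// leeD2l.
Qed.

(** [riesz_ball] reduces to balls and to another [S'] of the same measure, at the price of [e]; then
    [e] tends to 0. *)
Lemma corr_bound A B S (al be m dl t : R) : measurable A -> measurable B ->
  measurable S -> 0 < dl -> dl <= m -> m <= al -> m <= be ->
  0 <= t <= lens_volume d m dl ->
  mu A = mu (ball al) -> mu B = mu (ball be) ->
  (corrV A B S + t%:E * mu (ball (al + be - dl)) <= mu A * mu B + t%:E * mu S)%E.
Proof.
move=> mA mB mS dl0 dlm mal mbe tl Aa Bb.
have m0 : 0 < m by exact: lt_le_trans dlm.
have al0 : 0 < al by exact: lt_le_trans mal.
have be0 : 0 < be by exact: lt_le_trans mbe.
apply/lee_addgt0Pr => e e0.
have [||S' [mS' <- h]] := riesz_ball al0 be0 e0 mA mB mS; rewrite ?Aa ?Bb//.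
apply: (@le_trans _ _ (corrV (ball al) (ball be) S' + e%:E +
    t%:E * mu (ball (al + be - dl)))%E); first exact: leeD2r.
rewrite addeAC leeD2r//; exact: (vball_corr_bound dl0 dlm mal mbe tl mS').
Qed.

Lemma overlap_fin A B z : measurable A -> measurable B -> (mu A < +oo)%E ->
  overlap A B z \is a fin_num.
Proof.
move=> mA mB Aoo; rewrite ge0_fin_numE ?overlap_ge0//; apply: le_lt_trans Aoo.
apply: le_measure; rewrite ?inE//; first exact: measurable_overlap_slice.
by move=> x [].
Qed.

(** For [S = {f > t}] the integral of [min(f, t)] plus [corrV A B S] equals [|A||B| + t|S|], so
    [corr_bound] is exactly this inequality. *)
Lemma integral_min_overlap_ge A B (al be m dl t : R) : measurable A -> measurable B ->
  0 < dl -> dl <= m -> m <= al -> m <= be ->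
  0 <= t <= lens_volume d m dl ->
  mu A = mu (ball al) -> mu B = mu (ball be) ->
  (t%:E * mu (ball (al + be - dl)) <=
    \int[mu]_z (Num.min (fine (overlap A B z)) t)%:E)%E.
Proof.
move=> mA mB dl0 dlm mal mbe tl Aa Bb.
have Aoo : (mu A < +oo)%E by rewrite Aa vball_ltoo.
have Boo : (mu B < +oo)%E by rewrite Bb vball_ltoo.
have t0 : 0 <= t by case/andP: tl.
have cf z := overlap_fin z mA mB Aoo.
pose f z := fine (overlap A B z).
have fE z : (f z)%:E = overlap A B z by rewrite fineK.
have f0 z : 0 <= f z by rewrite fine_ge0// overlap_ge0.
have mf : measurable_fun setT f.
  by apply: measurableT_comp => //; exact: measurable_overlap.
pose S := [set z | t < f z].
have mS : measurable S.
  rewrite (_ : S = f @^-1` `]t, +oo[%classic).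
    by rewrite -[X in measurable X]setTI; exact: mf.
  by apply/seteqP; split => z /=; rewrite in_itv/= andbT.
have h := corr_bound mA mB mS dl0 dlm mal mbe tl Aa Bb.
have fS : corrV A B S \is a fin_num.
  rewrite ge0_fin_numE ?measure_ge0// (le_lt_trans (corrV_leM mA mB mS))//.
  by rewrite lte_mul_pinfty// ge0_fin_numE.
have mmin : measurable_fun setT (fun z => (Num.min (f z) t)%:E).
  by apply/measurable_EFinP; apply: measurable_minr.
have mc := measurable_overlap mA mB.
have mcS : measurable_fun setT ((overlap A B) \_ S).
  by apply/(measurable_restrictT _ _).1 => //; apply: measurable_funTS.
have mtS : measurable_fun setT ((cst t%:E : V -> \bar R) \_ S).
  by apply/(measurable_restrictT _ _).1 => //; exact: measurable_cst.
have c0S z : (0 <= ((overlap A B) \_ S) z)%E.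
  by rewrite patchE; case: ifP => // _; exact: overlap_ge0.
have t0S z : (0 <= ((cst t%:E : V -> \bar R) \_ S) z)%E.
  by rewrite patchE; case: ifP => // _; rewrite lee_fin.
have E : (\int[mu]_z (Num.min (f z) t)%:E + corrV A B S = mu A * mu B + t%:E * mu S)%E.
  rewrite -(corrV_setT mA mB) !corrV_overlap// (integral_mkcond S).
  have -> : (t%:E * mu S)%E = (\int[mu]_z ((cst t%:E) \_ S) z)%E.
    by rewrite -integral_mkcond integral_cst.
  rewrite -!ge0_integralD//.
  - apply: eq_integral => z _; rewrite !patchE; case: ifPn => [|].
      rewrite inE /S/= => tf; rewrite min_r; last exact: ltW.
      by rewrite addeC.
    by rewrite notin_setE /S/= => /negP; rewrite -leNgt => ft; rewrite min_l ?fE.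
  - by move=> z _; rewrite lee_fin le_min f0.
by move: h; rewrite -E [leRHS]addeC leeD2lE.
Qed.

End truncated_integral.

(** * Reduction to truncations *)

Section interpolation.
Context {R : realType}.

(* The concave piecewise linear function with slope 2^-(j+1) on [j, j+1] lies
   below 1 - e^-x; weight j is its second difference at the node j+1. *)
Definition weight (j : nat) : R := 2^-1 ^+ j.+2.

Lemma weight_gt0 j : 0 < weight j.
Proof. by rewrite exprn_gt0// invr_gt0. Qed.

Lemma weightS j : weight j.+1 = weight j / 2.
Proof. by rewrite /weight exprSr. Qed.

Lemma sum_weight K : \sum_(j < K) weight j = 2^-1 - 2^-1 ^+ K.+1.
Proof.
elim: K => [|K IH]; first by rewrite big_ord0 expr1 subrr.
by rewrite big_ord_recr/= IH /weight !exprS; move: (_ ^+ K) => x; field.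
Qed.

(** The sum is self-similar: for [x > 1] it is at most [1/2] plus half of the sum with one term
    fewer at [x - 1], and [2 e^-x <= e^-(x-1)] because [e >= 2]. For [x <= 1] it is at most [x/2],
    and [e^-x <= 1/(1+x) <= 1 - x/2]. *)
Lemma interpolation_exp K (x : R) : 0 <= x ->
  \sum_(j < K) weight j * Num.min x j.+1%:R <= 1 - expR (- x).
Proof.
elim: K x => [|K IH] x x0.
  by rewrite big_ord0 subr_ge0 -expR0 ler_expR oppr_le0.
have [x1|x1] := leP x 1.
  apply: (@le_trans _ _ (x / 2)).
    rewrite (eq_bigr (fun j : 'I__ => weight j * x)); last first.
      by move=> j _; rewrite min_l// (le_trans x1)// ler1n.
    have hK : 0 <= (2^-1 : R) ^+ K.+2 by rewrite exprn_ge0// invr_ge0.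
    rewrite -mulr_suml sum_weight; move: hK; move: (_ ^+ _) => u u0; nra.
  have e1 : expR (- x) <= (1 + x)^-1.
    by rewrite expRN lef_pV2 ?posrE ?expR_gt0 ?expR_ge1Dx// ltr_wpDr.
  have e2 : (1 + x)^-1 <= 1 - x / 2.
    by rewrite -[_^-1]mul1r ler_pdivrMr; nra.
  lra.
rewrite big_ord_recl min_r /=; last exact: ltW.
rewrite (eq_bigr (fun j : 'I__ => weight j / 2 +
    2^-1 * (weight j * Num.min (x - 1) j.+1%:R))); last first.
  move=> j _; rewrite /bump/= add1n weightS.
  have -> : Num.min x j.+2%:R = 1 + Num.min (x - 1) j.+1%:R.
    have xx : 1 + (x - 1) = x by lra.
    by rewrite addr_minr nat1r xx.
  by ring.
rewrite big_split/=.
have -> : \sum_(j < K) weight j / 2 = (\sum_(j < K) weight j) / 2.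
  by rewrite mulr_suml.
have -> : \sum_(j < K) 2^-1 * (weight j * Num.min (x - 1) j.+1%:R) =
    2^-1 * \sum_(j < K) weight j * Num.min (x - 1) j.+1%:R.
  by rewrite mulr_sumr.
rewrite sum_weight.
have := IH (x - 1); rewrite subr_ge0 (ltW x1) => /(_ isT) h.
have e : 2 * expR (- x) <= expR (- (x - 1)).
  rewrite opprB addrC expRD mulrC ler_pM2l ?expR_gt0//.
  by have := @expR_ge1Dx R 1; lra.
have hK : 0 <= (2^-1 : R) ^+ K.+1 by rewrite exprn_ge0// invr_ge0.
have -> : weight 0 = 4^-1 :> R by rewrite /weight expr2 -invfM -natrM.
move: h e hK; move: (expR _) (expR _) (2^-1 ^+ _) (\sum_(j < K) _) => u v p S.
lra.
Qed.

(** The limit 1 accounts for the full main term; the deficit, at most [2/N] by [sum_weight1_ge], is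
    the 2 in the final constant. *)
Lemma sum_weight1 N : \sum_(j < N) weight j * j.+1%:R =
  1 - (N + 2)%:R * 2^-1 ^+ N.+1 :> R.
Proof.
elim: N => [|N IH]; first by rewrite big_ord0 expr1 divff ?subrr.
rewrite big_ord_recr/= IH /weight !exprS -!natr1 !natrD -!natr1.
by move: (_ ^+ N) (N%:R) => x y; field.
Qed.

(** The sum over all weights is 3, the factor of [lens_const] in the final constant. *)
Lemma sum_weight2_le N : \sum_(j < N) weight j * j.+1%:R ^+ 2 <= 3 :> R.
Proof.
suff -> : \sum_(j < N) weight j * j.+1%:R ^+ 2 =
  3 - (N%:R ^+ 2 + 4 * N%:R + 6) * 2^-1 ^+ N.+1 :> R.
  by rewrite gerBl mulr_ge0 ?exprn_ge0 ?invr_ge0// !addr_ge0 ?exprn_ge0// mulr_ge0.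
elim: N => [|N IH]; first by rewrite big_ord0 expr1 expr0n/=; field.
rewrite big_ord_recr/= IH /weight !exprS -!natr1.
by move: (_ ^+ N) (N%:R) => x y; field.
Qed.

Lemma sum_weight1_ge N : (0 < N)%N ->
  1 - 2 / N%:R <= \sum_(j < N) weight j * j.+1%:R :> R.
Proof.
move=> N0; rewrite sum_weight1 lerD2l lerN2.
have h : (N * (N + 2) <= 2 ^ N.+2)%N.
  elim: N N0 => // -[|[|N]]// IH _; have := IH isT.
  by rewrite (expnS 2 N.+4); lia.
rewrite exprVn ler_pdivrMr ?exprn_gt0// mulrAC ler_pdivlMr ?ltr0n//.
by rewrite -exprS -natrX -natrM ler_nat mulnC.
Qed.

(** [(1 - s/b)^N <= e^-x] with [x = N s/b], to which [interpolation_exp] applies. The node [j+1]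
    becomes the level [(j+1) b/N], and with [N] nodes the last level is [b]. *)
Lemma concave_ge (N : nat) (b s : R) : (0 < N)%N -> 0 < b -> 0 <= s -> s <= b ->
  \sum_(j < N) (weight j * (N%:R / b)) * Num.min s (j.+1%:R * b / N%:R) <=
  1 - (1 - s / b) ^+ N.
Proof.
move=> N0 b0 s0 sb.
have N0' : 0 < N%:R :> R by rewrite ltr0n.
have Nb : 0 < N%:R / b by rewrite divr_gt0.
have sb1 : 0 <= 1 - s / b by rewrite subr_ge0 ler_pdivrMr// mul1r.
apply: (@le_trans _ _ (1 - expR (- (N%:R / b * s)))).
  apply: le_trans (interpolation_exp N _); last by rewrite mulr_ge0// ltW.
  rewrite le_eqVlt; apply/orP; left; apply/eqP; apply: eq_bigr => j _.
  rewrite -mulrA; congr (_ * _); rewrite minr_pMr ?ltW//; congr Num.min.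
  by field; rewrite !gt_eqF.
rewrite lerD2l lerN2.
have -> : - (N%:R / b * s) = N%:R * - (s / b) by field; rewrite gt_eqF.
rewrite expRM_natl; apply: lerXn2r; rewrite ?nnegrE ?expR_ge0//.
exact: expR_ge1Dx.
Qed.

Lemma bernoulli (n : nat) (x : R) : 0 <= x <= 1 -> 1 - n%:R * x <= (1 - x) ^+ n.
Proof.
move=> /andP[x0 x1]; elim: n => [|n IH]; first by rewrite mul0r subr0 expr0.
rewrite exprS (le_trans _ (ler_wpM2l _ IH)) ?subr_ge0// -natr1.
have n0 : 0 <= n%:R :> R by [].
have := mulr_ge0 n0 (sqr_ge0 x); rewrite expr2; lra.
Qed.

End interpolation.

(** * The integral of the hitting probability *)

Section union_bound.
Context {R : realType} (d : nat).
Local Notation V := (borel_rV R d.+1).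
Local Notation mu := (mu_rV R d.+1).
Local Notation ball := (vball d.+1).
Implicit Types (A B S : set V).

Definition omega : R := fine (mu (ball 1)).

Lemma omegaE : mu (ball 1) = omega%:E.
Proof. by rewrite fineK// ge0_fin_numE// vball_ltoo. Qed.

Lemma omega_gt0 : 0 < omega.
Proof. by rewrite -lte_fin -omegaE vball_gt0. Qed.

Lemma mu_ballE r : 0 < r -> mu (ball r) = (omega * r ^+ d.+1)%:E.
Proof. by move=> r0; rewrite mu_vball// omegaE -EFinM mulrC. Qed.

(** The exponent [2/(D+1)] for the dimension [D = d.+1]. *)
Let p : R := 2 / d.+2%:R.

Let p_le1 : p <= 1.
Proof. by rewrite ler_pdivrMr// mul1r ler_nat. Qed.

(** Lens volume grows like the power [(d+2)/2 = 1/p] of the depth; this inverts that relation. *)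
Lemma sqrt_powR_expn (y : R) : 0 <= y ->
  Num.sqrt (y `^ p) ^+ d * y `^ p = y.
Proof.
move=> y0; set u := Num.sqrt (y `^ p).
have -> : y `^ p = u ^+ 2 by rewrite sqr_sqrtr// powR_ge0.
rewrite -exprD addn2 /u -powR12_sqrt ?powR_ge0// -powRrM -powR_mulrn ?powR_ge0//.
rewrite -powRrM (_ : _ * _ = 1) ?powRr1//.
have : (d.+2%:R : R) != 0 by rewrite pnatr_eq0.
by rewrite /p; set D := d.+2%:R => D0; field.
Qed.

(** [lens_volume d m0 eta = kappa m0 * eta^((d+2)/2)] for [eta >= 0]. *)
Definition kappa (m0 : R) : R := Num.sqrt (m0 / d.+1%:R) ^+ d / 2.
(** [(omega / kappa m0 * tau)^p] is the relative depth [eta] at level [tau]. The factor [d.+1] comes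
    from Bernoulli's inequality, and [1/m0] makes the bound vacuous once [eta > m0]. *)
Definition lens_const (m0 : R) : R := d.+1%:R / m0 * (omega / kappa m0) `^ p.

Lemma kappa_gt0 m0 : 0 < m0 -> 0 < kappa m0.
Proof. by move=> m00; rewrite divr_gt0// exprn_gt0// sqrtr_gt0 divr_gt0. Qed.

Lemma lens_const_ge0 m0 : 0 < m0 -> 0 <= lens_const m0.
Proof. by move=> m00; rewrite mulr_ge0 ?powR_ge0// divr_ge0// ltW. Qed.

(** At this depth the guaranteed overlap is exactly the level [tau |B|]. *)
Lemma lens_volume_scaled (be m0 tau : R) : 0 < be -> 0 < m0 -> 0 < tau ->
  lens_volume d (be * m0) (be * (omega / kappa m0 * tau) `^ p) =
  tau * (omega * be ^+ d.+1).
Proof.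
move=> be0 m00 tau0; have k0 := kappa_gt0 m00; have o0 := omega_gt0.
have y0 : 0 < omega / kappa m0 * tau by rewrite mulr_gt0// divr_gt0.
rewrite /lens_volume; set y := omega / kappa m0 * tau in y0 *.
have -> : be * m0 * (be * y `^ p) / d.+1%:R = be ^+ 2 * (m0 / d.+1%:R) * y `^ p.
  have : (d.+1%:R : R) != 0 by rewrite pnatr_eq0.
  by rewrite expr2; set D := d.+1%:R => D0; field.
rewrite sqrtrM ?mulr_ge0 ?exprn_ge0 ?divr_ge0 ?ltW//.
rewrite sqrtrM ?exprn_ge0 ?ltW// sqrtr_sqr gtr0_norm// !exprMn.
have := sqrt_powR_expn (ltW y0); set u := Num.sqrt (y `^ p) ^+ d => uy.
have -> : be ^+ d * Num.sqrt (m0 / d.+1%:R) ^+ d * u * (be * y `^ p / 2) =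
    be ^+ d.+1 * kappa m0 * (u * y `^ p).
  by rewrite /kappa exprS; field.
by rewrite uy /y; field; rewrite gt_eqF.
Qed.

Lemma min_bound A B (al be m0 tau : R) : measurable A -> measurable B ->
  0 < al -> 0 < be -> mu A = mu (ball al) -> mu B = mu (ball be) ->
  0 < m0 -> m0 <= 1 -> m0 <= al / be -> 0 < tau ->
  ((tau * (omega * be ^+ d.+1) *
    (omega * (al + be) ^+ d.+1 * (1 - lens_const m0 * tau `^ p)))%:E <=
   \int[mu]_z (Num.min (fine (overlap B A z)) (tau * (omega * be ^+ d.+1)))%:E)%E.
Proof.
move=> mA mB al0 be0 Aa Bb m00 m01 mab tau0.
have k0 := kappa_gt0 m00; have o0 := omega_gt0.
have y0 : 0 < omega / kappa m0 * tau by rewrite mulr_gt0// divr_gt0.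
set t := tau * (omega * be ^+ d.+1).
have t0 : 0 < t by rewrite !mulr_gt0// exprn_gt0.
pose eta := (omega / kappa m0 * tau) `^ p.
have eta0 : 0 < eta by rewrite powR_gt0.
have CE : lens_const m0 * tau `^ p = d.+1%:R / m0 * eta.
  rewrite /lens_const /eta [(_ * tau) `^ p]powRM; [by rewrite mulrA| |exact: ltW].
  by apply: ltW; rewrite divr_gt0.
have ab0 : 0 < al + be by rewrite addr_gt0.
(* For [eta > m0] no lens of this depth is available, but then [d.+1 / m0 * eta >= 1] and the
   left-hand side is not positive. *)
rewrite CE; have [em|me] := leP eta m0; last first.
  apply: (@le_trans _ _ 0%E); last first.
    apply: integral_ge0 => z _; rewrite lee_fin le_min (ltW t0) andbT.
    by rewrite fine_ge0// overlap_ge0.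
  rewrite lee_fin pmulr_rle0// pmulr_rle0 ?mulr_gt0 ?exprn_gt0//.
  rewrite subr_le0 (@le_trans _ _ (d.+1%:R))// ?ler1n//.
  by rewrite mulrAC ler_pdivlMr// ler_wpM2l// ltW.
pose dl := be * eta.
have dl0 : 0 < dl by rewrite mulr_gt0.
have dlm : dl <= be * m0 by rewrite ler_pM2l.
have mbe : be * m0 <= be by rewrite ger_pMr.
have mal : be * m0 <= al by rewrite mulrC -ler_pdivlMr.
have tl : 0 <= t <= lens_volume d (be * m0) dl.
  by rewrite ltW//= /dl lens_volume_scaled.
have r0 : 0 < be + al - dl by lra.
apply: le_trans (integral_min_overlap_ge mB mA dl0 dlm mbe mal tl Bb Aa).
rewrite mu_ballE// -EFinM lee_fin ler_pM2l// -mulrA ler_pM2l//.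
(* The relative loss of radius: [x <= eta <= eta / m0] as [be <= al + be] and [m0 <= 1]. *)
pose x := dl / (al + be).
have x0 : 0 <= x by rewrite divr_ge0// ltW.
have xe : x <= eta.
  rewrite /x ler_pdivrMr// /dl mulrC ler_pM2l//; lra.
have x1 : x <= 1 by lra.
have -> : be + al - dl = (al + be) * (1 - x) by rewrite /x; field; rewrite gt_eqF.
rewrite exprMn ler_pM2l ?exprn_gt0//; apply: le_trans (bernoulli _ _); last by rewrite x0.
rewrite lerD2l lerN2 -mulrA ler_pM2l ?ltr0n// (le_trans xe)//.
by rewrite ler_pdivlMl// ger_pMl.
Qed.

(** [concave_ge] pointwise, then [min_bound] at each level [tau = (j+1)/N]; the two moments of the
    weights give the 2 and the 3. *)
Lemma union_integral_ge A B (al be m0 : R) (N : nat) : measurable A -> measurable B ->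
  0 < al -> 0 < be -> mu A = mu (ball al) -> mu B = mu (ball be) ->
  0 < m0 -> m0 <= 1 -> m0 <= al / be -> (0 < N)%N ->
  ((omega * (al + be) ^+ d.+1 * (1 - (2 + 3 * lens_const m0) * N%:R `^ (- p)))%:E <=
   \int[mu]_z (1 - (1 - fine (overlap B A z) / (omega * be ^+ d.+1)) ^+ N)%:E)%E.
Proof.
move=> mA mB al0 be0 Aa Bb m00 m01 mab N0.
have o0 := omega_gt0.
set b := omega * be ^+ d.+1.
have b0 : 0 < b by rewrite mulr_gt0// exprn_gt0.
have N0' : 0 < N%:R :> R by rewrite ltr0n.
have BE : mu B = b%:E by rewrite Bb mu_ballE.
pose f z := fine (overlap B A z).
have Boo : (mu B < +oo)%E by rewrite BE ltry.
have fE z : (f z)%:E = overlap B A z by rewrite fineK// overlap_fin.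
have f0 z : 0 <= f z by rewrite fine_ge0// overlap_ge0.
have fb z : f z <= b.
  rewrite -lee_fin fE -BE; apply: le_measure; rewrite ?inE//.
    exact: measurable_overlap_slice.
  by move=> x [].
have mf : measurable_fun setT f.
  by apply: measurableT_comp => //; exact: measurable_overlap.
pose g (j : nat) z := (weight j * (N%:R / b) * Num.min (f z) (j.+1%:R * b / N%:R))%:E.
have c0 j : 0 <= weight j * (N%:R / b) by rewrite mulr_ge0 ?divr_ge0 ?ltW// weight_gt0.
have g0 j z : (0 <= g j z)%E.
  by rewrite lee_fin mulr_ge0// le_min f0 divr_ge0// mulr_ge0// ltW.
have mmin (s : R) : measurable_fun setT (fun z => Num.min (f z) s).
  exact: measurable_minr.
have mg j : measurable_fun setT (g j).
  by apply/measurable_EFinP; apply: measurable_funM.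
apply: (@le_trans _ _ (\int[mu]_z \sum_(j < N) g j z)%E); last first.
  apply: ge0_le_integral => //.
  - by move=> z _; apply: sume_ge0 => j _; exact: g0.
  - by apply: emeasurable_sum => j; exact: mg.
  - apply/measurable_EFinP; apply: measurable_funB => //.
    apply: measurable_funX; apply: measurable_funB => //.
    exact: measurable_funM.
  move=> z _; rewrite /g sumEFin lee_fin; exact: concave_ge.
rewrite ge0_integral_sum//.
pose M := omega * (al + be) ^+ d.+1.
have M0 : 0 < M by rewrite mulr_gt0// exprn_gt0// addr_gt0.
pose C := lens_const m0.
have C0 : 0 <= C by exact: lens_const_ge0.
apply: (@le_trans _ _ (\sum_(j < N)
    (weight j * j.+1%:R * (M * (1 - C * (j.+1%:R / N%:R) `^ p)))%:E)%E); last first.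
  apply: lee_sum => j _.
  have -> : (\int[mu]_z g j z)%E = ((weight j * (N%:R / b))%:E *
      \int[mu]_z (Num.min (f z) (j.+1%:R * b / N%:R))%:E)%E.
    rewrite -ge0_integralZl//.
    - by apply/measurable_EFinP.
    - by move=> z _; rewrite lee_fin le_min f0 divr_ge0// mulr_ge0// ltW.
    - by rewrite lee_fin.
  have tau0 : 0 < j.+1%:R / N%:R :> R by rewrite divr_gt0// ltr0n.
  have := min_bound mA mB al0 be0 Aa Bb m00 m01 mab tau0.
  rewrite -/b (mulrAC _ _ b) => h.
  apply: le_trans (lee_wpmul2l _ h); last by rewrite lee_fin.
  rewrite -EFinM lee_fin -/M -/C le_eqVlt; apply/orP; left; apply/eqP.
  by field; rewrite !gt_eqF.
rewrite sumEFin lee_fin -/M -/C.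
have Np0 : 0 <= N%:R `^ (- p) :> R by exact: powR_ge0.
(* Since [p <= 1], [(j+1)^p <= j+1], which turns the loss into a second moment of the weights. *)
have termE (j : 'I_N) : weight j * j.+1%:R * (M * (1 - C * N%:R `^ (- p) * j.+1%:R)) <=
    weight j * j.+1%:R * (M * (1 - C * (j.+1%:R / N%:R) `^ p)).
  have w0 : 0 <= weight j * j.+1%:R :> R by rewrite mulr_ge0// ltW// weight_gt0.
  rewrite ler_wpM2l// ler_pM2l// lerD2l lerN2.
  rewrite -mulrA ler_wpM2l// powRM ?invr_ge0//.
  rewrite -[N%:R^-1]powR_inv1// -powRrM mulN1r mulrC ler_wpM2l//.
  by rewrite -[leRHS]powRr1// ler_powR ?ler1n.
apply: le_trans (ler_sum _ (fun j _ => termE j)).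
have -> : \sum_(j < N) weight j * j.+1%:R * (M * (1 - C * N%:R `^ (- p) * j.+1%:R)) =
  M * (\sum_(j < N) weight j * j.+1%:R) -
  M * (C * N%:R `^ (- p)) * \sum_(j < N) weight j * j.+1%:R ^+ 2.
  rewrite !mulr_sumr -sumrB; apply: eq_bigr => j _; ring.
have h1 := @sum_weight1_ge R N N0; have h2 := @sum_weight2_le R N.
have h3 : 2 / N%:R <= 2 * N%:R `^ (- p) :> R.
  by rewrite ler_pM2l// -[N%:R^-1]powR_inv1// ler_powR ?ler1n// lerN2 p_le1.
have h4 : 0 <= C * N%:R `^ (- p) by rewrite mulr_ge0.
rewrite -mulrA -mulrBr ler_pM2l//.
have := ler_wpM2l h4 h2; lra.
Qed.

End union_bound.

(** * Random translates *)

Section random_translates.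
Context {R : realType} {d : nat}.
Local Notation outer := (@lebesgue_outer_rV R d).
Local Notation V := (borel_rV R d).
Local Notation mu := (mu_rV R d).

Lemma lebesgue_outer_rVU (X Y : set 'rV[R]_d) :
  (outer (X `|` Y) <= outer X + outer Y)%E.
Proof. exact: outer_measureU2. Qed.

Lemma outer_ae_eq (X Y N : set 'rV[R]_d) : Y `<=` X -> X `<=` Y `|` N ->
  outer N = 0%E -> outer X = outer Y.
Proof.
move=> YX XYN N0; apply/eqP; rewrite eq_le; apply/andP; split; last first.
  exact: le_lebesgue_outer_rV.
rewrite (le_trans (le_lebesgue_outer_rV XYN))//.
by rewrite (le_trans (lebesgue_outer_rVU _ _))// N0 adde0.
Qed.

Definition hit (n : nat) (A : set V) (b : 'I_n -> V) : set V :=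
  [set x | exists i, A (subV x (b i))].

Lemma measurable_hit_i (A : set V) (c : V) : measurable A ->
  measurable [set x | A (subV x c)].
Proof.
apply: (measurable_preimage (f := fun x => subV x c)).
exact: measurable_fun_subV.
Qed.

(** Induction over a finite union, shared by measurability, nullity and finiteness of [hit]. *)
Lemma hit_ind (Q : set V -> Prop) n A (b : 'I_n -> V) : Q set0 ->
  (forall X Y, Q X -> Q Y -> Q (X `|` Y)) ->
  (forall i, Q [set x | A (subV x (b i))]) -> Q (hit A b).
Proof.
move=> Q0 QU Qi.
suff h (s : seq 'I_n) : Q [set x | exists2 i, i \in s & A (subV x (b i))].
  have := h (enum 'I_n); congr Q; apply/seteqP; split => x.
    by case=> i _ ?; exists i.
  by case=> i ?; exists i => //; rewrite mem_enum.
elim: s => [|i s IH].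
  by have <- : set0 = [set x | exists2 i, i \in [::] & A (subV x (b i))];
    [apply/seteqP; split => // x []|].
rewrite (_ : mkset _ = [set x | A (subV x (b i))] `|`
   [set x | exists2 i, i \in s & A (subV x (b i))]); first exact: QU.
apply/seteqP; split => x.
  by case=> j; rewrite inE => /predU1P[->|js] Aj; [left|right; exists j].
by case=> [Ai|[j js Aj]]; [exists i|exists j]; rewrite // inE ?eqxx// js orbT.
Qed.

Lemma measurable_hit n A (b : 'I_n -> V) : measurable A -> measurable (hit A b).
Proof.
move=> mA; apply: hit_ind; [exact: measurable0|exact: measurableU|].
by move=> i; exact: measurable_hit_i.
Qed.

Lemma translate_subV (X : set 'rV[R]_d) (v : 'rV[R]_d) :
  translate X v = [set x | X (subV x v)].
Proof.
apply/seteqP; split => [_ [x Xx <-]|x Xx] /=; first by rewrite /subV addrK.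
by exists (subV x v) => //; rewrite /subV subrK.
Qed.

Lemma outer_subV (X : set 'rV[R]_d) (v : 'rV[R]_d) :
  outer [set x | X (subV x v)] = outer X.
Proof. by rewrite -translate_subV outer_translate. Qed.

Lemma outer_hit0 n (N : set V) (b : 'I_n -> V) : outer N = 0%E -> outer (hit N b) = 0%E.
Proof.
move=> N0; apply: (hit_ind (Q := fun X => outer X = 0%E)).
- exact: lebesgue_outer_rV0.
- move=> X Y X0 Y0; apply/eqP; rewrite eq_le lebesgue_outer_rV_ge0 andbT.
  by rewrite (le_trans (lebesgue_outer_rVU _ _))// X0 Y0 adde0.
- by move=> i; rewrite outer_subV.
Qed.

Lemma mu_hit_fin n (A : set V) (b : 'I_n -> V) : measurable A -> (mu A < +oo)%E ->
  (mu (hit A b) < +oo)%E.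
Proof.
move=> mA Aoo.
suff [] : measurable (hit A b) /\ (mu (hit A b) < +oo)%E by [].
apply: (hit_ind (Q := fun X => measurable X /\ (mu X < +oo)%E)).
- by split; [exact: measurable0|rewrite measure0].
- move=> X Y [mX Xoo] [mY Yoo]; split; first exact: measurableU.
  by rewrite (le_lt_trans (measureU2 _ mX mY))// lte_add_pinfty.
- move=> i; have mi := measurable_hit_i (b i) mA; split => //.
  by rewrite mu_outer// outer_subV -mu_outer.
Qed.

Lemma volume_union_translates n (A A0 N : set V) (b : 'I_n -> V) :
  A0 `<=` A -> A `<=` A0 `|` N -> outer N = 0%E -> measurable A0 ->
  volume (\bigcup_(i in [set: 'I_n]) translate A (b i)) = fine (mu (hit A0 b)).
Proof.
move=> A0A AA0 N0 mA0; rewrite mu_outer; last exact: measurable_hit.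
rewrite /volume /lebesgue_measure_rV; congr fine.
apply: (outer_ae_eq (N := hit N b)); last exact: outer_hit0.
- by move=> x [i A0x]; exists i => //; rewrite translate_subV; exact: A0A.
- move=> x [i _]; rewrite translate_subV => /AA0[h|h]; [left|right]; by exists i.
Qed.

(** For every outcome the volume equals that of the union of translates of the Borel core, a set
    jointly measurable in the outcome and the point, so Tonelli applies. *)
Lemma expected_volume disp (Omega : measurableType disp) (P : probability Omega R)
  n (A A0 N : set V) (b : 'I_n -> {RV P >-> V}) :
  A0 `<=` A -> A `<=` A0 `|` N -> outer N = 0%E -> measurable A0 -> (mu A0 < +oo)%E ->
  ('E_P[fun w => volume (\bigcup_(i in [set: 'I_n]) translate A (b i w))] =
   \int[mu]_x P [set w | exists i, A0 (subV x (b i w))])%E.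
Proof.
move=> A0A AA0 N0 mA0 A0oo; rewrite unlock.
have mW : measurable [set p : Omega * V | exists i, A0 (subV p.2 (b i p.1))].
  rewrite (_ : mkset _ = \bigcup_(i in [set: 'I_n])
      [set p : Omega * V | A0 (subV p.2 (b i p.1))]); last first.
    by apply/seteqP; split => p [i]; [exists i|move=> _ ?; exists i].
  apply: fin_bigcup_measurable => // i _.
  apply: (measurable_preimage (f := fun p : Omega * V => subV p.2 (b i p.1))) => //.
  by apply: measurable_fun_subV => //; exact: measurableT_comp.
rewrite -(prodmE2 P mu mW) prodmE1; apply: eq_integral => w _.
rewrite (volume_union_translates (fun i => b i w) A0A AA0 N0 mA0) fineK//.
by rewrite ge0_fin_numE// mu_hit_fin.
Qed.

End random_translates.

(** * The probability that a point is covered *)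

Section hitting.
Context {R : realType} {d : nat}.
Local Notation outer := (@lebesgue_outer_rV R d.+1).
Local Notation V := (borel_rV R d.+1).
Local Notation mu := (mu_rV R d.+1).

Lemma outer_setI_borel (B B0 N T : set V) : B0 `<=` B -> B `<=` B0 `|` N ->
  outer N = 0%E -> measurable B0 -> measurable T -> outer (T `&` B) = mu (T `&` B0).
Proof.
move=> B0B BB0 N0 mB0 mT; rewrite mu_outer; last exact: measurableI.
apply: (outer_ae_eq (N := N)) => //; first exact: setIS.
by move=> x [Tx /BB0[|]]; [left|right].
Qed.

(** [x] is missed exactly when every [b i] avoids [H = {y | x - y in A0}], and [overlap B0 A0 x] is
    the measure of the part of [B0] in [H]. *)
Lemma hitting_probability disp (Omega : measurableType disp) (P : probability Omega R)
    n (b : 'I_n -> {RV P >-> V}) (A0 B B0 N : set V) (v : R) (x : V) :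
  B0 `<=` B -> B `<=` B0 `|` N -> outer N = 0%E -> measurable A0 -> measurable B0 ->
  mu B0 = v%:E -> 0 < v -> volume B = v ->
  mutually_independent b -> (forall i, uniform_on B (b i)) ->
  P [set w | exists i, A0 (subV x (b i w))] =
    (1 - (1 - fine (overlap B0 A0 x) / v) ^+ n)%:E.
Proof.
move=> B0B BB0 N0 mA0 mB0 B0v v0 Bv indep unif.
pose H : set V := [set y | A0 (subV x y)].
have mH : measurable H.
  apply: (measurable_preimage (f := fun y => subV x y)) => //.
  exact: measurable_fun_subV.
have mHC : measurable (~` H) by exact: measurableC.
have Bfin : (mu B0 < +oo)%E by rewrite B0v ltry.
have Of : overlap B0 A0 x = (fine (overlap B0 A0 x))%:E.
  by rewrite fineK// overlap_fin.
have Pi i : P (b i @^-1` (~` H)) = (1 - fine (overlap B0 A0 x) / v)%:E.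
  have := unif i (~` H) mHC; rewrite /distribution /pushforward => ->.
  rewrite Bv; congr EFin.
  rewrite /volume /lebesgue_measure_rV (outer_setI_borel B0B BB0 N0 mB0 mHC).
  have -> : mu (~` H `&` B0) = (mu B0 - overlap B0 A0 x)%E.
    rewrite setIC -setDE; have -> : mu (B0 `\` H) = (mu B0 - mu (B0 `&` H))%E.
      by apply: measureD => //=.
    by [].
  rewrite B0v Of -EFinB/=; field; by rewrite gt_eqF.
pose F i := b i @^-1` (~` H).
have PF : P (\bigcap_(i in [set` [set: 'I_n]%SET]) F i) =
    ((1 - fine (overlap B0 A0 x) / v) ^+ n)%:E.
  rewrite (indep [set: 'I_n]%SET (fun=> ~` H))//.
  rewrite (eq_bigr (fun=> (1 - fine (overlap B0 A0 x) / v)%:E))//.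
  rewrite big_const cardsT card_ord; elim: n {b indep unif Pi F} => //= n IH.
  by rewrite IH -EFinM exprS.
have mF i : measurable (F i).
  by apply: (measurable_preimage (f := b i)).
rewrite (_ : mkset _ = ~` \bigcap_(i in [set` [set: 'I_n]%SET]) F i); last first.
  apply/seteqP; split => w /=.
    by move=> [i Ai] h; apply: (h i) => //=; rewrite inE.
  by move=> /existsNP[i /not_implyP[_ /contrapT]] h; exists i.
rewrite probability_setC ?PF//.
by apply: fin_bigcap_measurable.
Qed.

End hitting.

Section roots.
Context {R : realType} (n : nat).
Local Notation r := (n.+1%:R^-1 : R).

Lemma powR_rootK (x : R) : 0 <= x -> (x `^ r) ^+ n.+1 = x.
Proof.
by move=> x0; rewrite -powR_mulrn ?powR_ge0// -powRrM mulVf ?powRr1// pnatr_eq0.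
Qed.

Lemma powR_exprK (x : R) : 0 <= x -> (x ^+ n.+1) `^ r = x.
Proof.
by move=> x0; rewrite -powR_mulrn// -powRrM mulfV ?powRr1// pnatr_eq0.
Qed.

Lemma powR_root_ratio (w x y : R) : 0 < w -> 0 < x -> 0 < y ->
  (w * x ^+ n.+1 / (w * y ^+ n.+1)) `^ r = x / y.
Proof.
move=> w0 x0 y0; rewrite -[RHS]powR_exprK ?divr_ge0 ?ltW//; congr (_ `^ r).
by rewrite expr_div_n; field; rewrite !gt_eqF ?exprn_gt0.
Qed.

Lemma powR_root_sum (w x y : R) : 0 < w -> 0 < x -> 0 < y ->
  ((w * x ^+ n.+1) `^ r + (w * y ^+ n.+1) `^ r) ^+ n.+1 = w * (x + y) ^+ n.+1.
Proof.
move=> w0 x0 y0; rewrite !powRM ?exprn_ge0 ?ltW// !powR_exprK ?ltW//.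
by rewrite -mulrDr exprMn powR_rootK// ltW.
Qed.

End roots.

Theorem corollary1p2 (R : realType) (d : nat) (d_gt0 : (0 < d)%N) :
  exists c : R -> R, forall A B : set 'rV[R]_d,
    lebesgue_measurable_rV A -> lebesgue_measurable_rV B ->
    (0 < lebesgue_measure_rV A < +oo)%E ->
    (0 < lebesgue_measure_rV B < +oo)%E ->
  exists2 o1 : nat -> R, o1 n @[n --> \oo] --> (0 : R) &
    forall n : nat, (0 < n)%N ->
    forall (disp : measure_display) (Omega : measurableType disp)
      (P : probability Omega R) (b : 'I_n -> {RV P >-> borel_rV R d}),
      mutually_independent b -> (forall i, uniform_on B (b i)) ->
    (((volume A `^ d%:R^-1 + volume B `^ d%:R^-1) ^+ d *
       (1 - (c (volume A / volume B) + o1 n) *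
              n%:R `^ (- (2 / d.+1%:R))))%:E <=
     'E_P[fun w => volume (\bigcup_(i in [set: 'I_n])
                             translate A (b i w))])%E.
Proof.
case: d d_gt0 => // d _.
(* At [x = |A|/|B|] the root is the ratio [al / be] of the radii, so [be * m0] is the smaller
   radius, and the constant depends on the volumes only through their ratio. *)
pose m0 (x : R) := Num.min (x `^ d.+1%:R^-1) 1.
exists (fun x => 2 + 3 * lens_const d (m0 x)) => A B mA mB /andP[A0 Aoo] /andP[B0 Boo].
(* The estimate holds for each [n] separately, so no error term is left. *)
exists (fun=> 0); first exact: cvg_cst.
move=> n n0 disp Omega P b indep unif.
have [A1 [NA [mA1 A1A NA0 AA1 A1E]]] := borel_approx mA Aoo.
have [B1 [NB [mB1 B1B NB0 BB1 B1E]]] := borel_approx mB Boo.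
have AE : mu_rV R d.+1 A1 = (volume A)%:E by rewrite A1E fineK// ge0_fin_numE// ltW.
have BE : mu_rV R d.+1 B1 = (volume B)%:E by rewrite B1E fineK// ge0_fin_numE// ltW.
have a0 : 0 < volume A by rewrite fine_gt0// A0 Aoo.
have b0 : 0 < volume B by rewrite fine_gt0// B0 Boo.
have o0 := @omega_gt0 R d.
have A1oo : (mu_rV R d.+1 A1 < +oo)%E by rewrite AE ltry.
rewrite (expected_volume b A1A AA1 NA0 mA1 A1oo).
pose al := (volume A / omega d) `^ d.+1%:R^-1.
pose be := (volume B / omega d) `^ d.+1%:R^-1.
have al0 : 0 < al by rewrite powR_gt0// divr_gt0.
have be0 : 0 < be by rewrite powR_gt0// divr_gt0.
have alE : omega d * al ^+ d.+1 = volume A.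
  by rewrite powR_rootK; [rewrite mulrC divfK// gt_eqF|rewrite divr_ge0// ltW].
have beE : omega d * be ^+ d.+1 = volume B.
  by rewrite powR_rootK; [rewrite mulrC divfK// gt_eqF|rewrite divr_ge0// ltW].
have mab : (volume A / volume B) `^ d.+1%:R^-1 = al / be.
  by rewrite -alE -beE powR_root_ratio.
have -> : (volume A `^ d.+1%:R^-1 + volume B `^ d.+1%:R^-1) ^+ d.+1 =
    omega d * (al + be) ^+ d.+1.
  by rewrite -alE -beE powR_root_sum.
rewrite addr0.
have hP x : P [set w | exists i, A1 (subV x (b i w))] =
    (1 - (1 - fine (overlap B1 A1 x) / (omega d * be ^+ d.+1)) ^+ n)%:E.
  by rewrite beE; exact: (hitting_probability x B1B BB1 NB0 mA1 mB1 BE b0 _ indep unif).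
under eq_integral do rewrite hP.
apply: union_integral_ge => //.
- by rewrite AE mu_ballE// alE.
- by rewrite BE mu_ballE// beE.
- by rewrite lt_min powR_gt0 ?divr_gt0//=.
- by rewrite ge_min lexx orbT.
- by rewrite /m0 mab ge_min lexx.
Qed.
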